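(* Let $n\geq 1$. The number of configurations of the twenty-vertex model with DWBC1 on the $n\times n$ grid and the number of configurations of the twenty-vertex model with DWBC2 on the $n\times n$ grid are both equal to $$Z^{6V}_{[1,\sqrt2,1]}(n)=\sum_{C}(\sqrt{2})^{\,b(C)},$$ where $C$ runs over all six-vertex configurations with domain wall boundary conditions on the $n\times n$ grid and $b(C)$ is the number of vertices of type $b$ in $C$.
   Context: Twenty-vertex (20V) model. Fix $n\ge 1$ and vertices $(x,y)\in\{1,\dots,n\}^2$. Inner edges: horizontal $\{(x,y),(x+1,y)\}$ ($x<n$), vertical $\{(x,y),(x,y+1)\}$ ($y<n$), diagonal $\{(x,y+1),(x+1,y)\}$ ($x,y<n$). Boundary edges with prescribed orientations: West: from $(0,y)$ to $(1,y)$ ($1\le y\le n$) and from $(0,y+1)$ to $(1,y)$ ($1\le y\le n-1$); South: from $(x,1)$ to $(x,0)$ ($1\le x\le n$) and from $(x,1)$ to $(x+1,0)$ ($1\le x\le n-1$); East: from $(n+1,y)$ to $(n,y)$ ($1\le y\le n$) and from $(n+1,y)$ to $(n,y+1)$ ($1\le y\le n-1$); North: from $(x,n)$ to $(x,n+1)$ ($1\le x\le n$) and from $(x+1,n)$ to $(x,n+1)$ ($1\le x\le n-1$). Two further corner diagonal edges: for DWBC1 they are oriented from $(0,n+1)$ to $(1,n)$ and from $(n,1)$ to $(n+1,0)$; for DWBC2 they are oriented from $(1,n)$ to $(0,n+1)$ and from $(n+1,0)$ to $(n,1)$. Every vertex then has exactly six incident edges. A configuration (with DWBC1, resp. DWBC2)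 is an orientation of all inner edges such that at every vertex exactly three incident edges point towards it and three point away from it. Six-vertex (6V) model with domain wall boundary conditions (DWBC). Vertices $(x,y)\in\{1,\dots,n\}^2$, inner edges the horizontal and vertical edges between neighbouring vertices, and boundary edges oriented from $(0,y)$ to $(1,y)$ (West), from $(n+1,y)$ to $(n,y)$ (East), from $(x,1)$ to $(x,0)$ (South), from $(x,n)$ to $(x,n+1)$ (North). A configuration is an orientation of the inner edges such that every vertex has exactly two incoming and two outgoing incident edges. Call an edge occupied if it is horizontal and oriented West-to-East or vertical and oriented North-to-South. A vertex is of type $a$ if all four or none of its incident edges are occupied, of type $b$ if exactly its two horizontal or exactly its two vertical edges are occupied, and of type $c$ otherwise (exactly its West and South edges, or exactly its North and East edges, are occupied). *)

(* Defs.v *)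
From mathcomp Require Import all_boot.

Set Implicit Arguments.
Unset Strict Implicit.
Unset Printing Implicit Defensive.

Definition point := (nat * nat)%type.

(* Directed edges: (u, v) is the edge {u, v} oriented from u to v. *)
Definition dedge := (point * point)%type.

Definition rev_dedge (e : dedge) : dedge := (e.2, e.1).

(* Each undirected edge is listed once, with an arbitrary reference
   direction; an orientation maps the edge to true when it is oriented in
   its reference direction and to false when it is reversed. *)
Definition orientation (E : seq dedge) := {ffun seq_sub E -> bool}.

Definition arcs_of (E : seq dedge) (o : orientation E) : seq dedge :=
  [seq if o e then ssval e else rev_dedge (ssval e) | e <- enum {: seq_sub E}].

Definition indeg (A : seq dedge) (v : point) := count (fun a => a.2 == v) A.
Definition outdeg (A : seq dedge) (v : point) := count (fun a => a.1 == v) A.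

Definition vertices (n : nat) : seq point :=
  [seq (x, y) | x <- index_iota 1 n.+1, y <- index_iota 1 n.+1].

Definition balanced (n k : nat) (A : seq dedge) : bool :=
  all (fun v => (indeg A v == k) && (outdeg A v == k)) (vertices n).

Definition horizontal_edges (n : nat) : seq dedge :=
  [seq ((x, y), (x.+1, y)) | x <- index_iota 1 n, y <- index_iota 1 n.+1].
Definition vertical_edges (n : nat) : seq dedge :=
  [seq ((x, y), (x, y.+1)) | x <- index_iota 1 n.+1, y <- index_iota 1 n].
Definition diagonal_edges (n : nat) : seq dedge :=
  [seq ((x, y.+1), (x.+1, y)) | x <- index_iota 1 n, y <- index_iota 1 n].

(* West, South, East and North horizontal and vertical boundary arcs. *)
Definition boundary6V (n : nat) : seq dedge :=
     [seq ((0, y), (1, y)) | y <- index_iota 1 n.+1]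
  ++ [seq ((x, 1), (x, 0)) | x <- index_iota 1 n.+1]
  ++ [seq ((n.+1, y), (n, y)) | y <- index_iota 1 n.+1]
  ++ [seq ((x, n), (x, n.+1)) | x <- index_iota 1 n.+1].

(* West, South, East and North diagonal boundary arcs, without the corners. *)
Definition boundary_diagonals (n : nat) : seq dedge :=
     [seq ((0, y.+1), (1, y)) | y <- index_iota 1 n]
  ++ [seq ((x, 1), (x.+1, 0)) | x <- index_iota 1 n]
  ++ [seq ((n.+1, y), (n, y.+1)) | y <- index_iota 1 n]
  ++ [seq ((x.+1, n), (x, n.+1)) | x <- index_iota 1 n].

Inductive dwbc := DWBC1 | DWBC2.

Definition corner_diagonals (bc : dwbc) (n : nat) : seq dedge :=
  match bc with
  | DWBC1 => [:: ((0, n.+1), (1, n)); ((n, 1), (n.+1, 0))]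
  | DWBC2 => [:: ((1, n), (0, n.+1)); ((n.+1, 0), (n, 1))]
  end.

Definition inner20V (n : nat) : seq dedge :=
  horizontal_edges n ++ vertical_edges n ++ diagonal_edges n.

Definition boundary20V (bc : dwbc) (n : nat) : seq dedge :=
  boundary6V n ++ boundary_diagonals n ++ corner_diagonals bc n.

Definition config20V (bc : dwbc) (n : nat) : {set orientation (inner20V n)} :=
  [set o | balanced n 3 (arcs_of o ++ boundary20V bc n)].

Definition inner6V (n : nat) : seq dedge :=
  horizontal_edges n ++ vertical_edges n.

Definition arcs6V (n : nat) (o : orientation (inner6V n)) : seq dedge :=
  arcs_of o ++ boundary6V n.

Definition config6V (n : nat) : {set orientation (inner6V n)} :=
  [set o | balanced n 2 (arcs6V o)].

(* The four edges at v, in the order West, East, North, South, each directed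
   as when occupied: West to East or North to South. *)
Definition occupied_directions (v : point) : seq dedge :=
  let: (x, y) := v in
  [:: ((x.-1, y), (x, y)); ((x, y), (x.+1, y));
      ((x, y.+1), (x, y)); ((x, y), (x, y.-1))].

Definition occupation (A : seq dedge) (v : point) : bitseq :=
  [seq a \in A | a <- occupied_directions v].

Definition type_b (A : seq dedge) (v : point) : bool :=
  (occupation A v == [:: true; true; false; false])
  || (occupation A v == [:: false; false; true; true]).

Definition count_b (n : nat) (o : orientation (inner6V n)) : nat :=
  count (type_b (arcs6V o)) (vertices n).

(* Main.v *)
(** Resolve every vertex of the twenty-vertex model into three pairwise
    crossings of the horizontal, vertical and diagonal lines through it, with
    six-vertex weights [a : b : c] equal to [1 : sqrt 2 : 1] for
    horizontal-vertical crossings and [sqrt 2 : 1 : 1] for the crossings with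
    the diagonal.  The Yang-Baxter equation holds, and either resolution gives
    each of the twenty local configurations the same weight 2.  A diagonal line
    can therefore be pushed across the horizontal-vertical lattice: the lines
    oriented to the south-east to the south-west boundary, the others to the
    north-east boundary.  There all its crossings are frozen by the boundary
    conditions, with weight [sqrt 2] each; there are two crossings for every
    vertex on the line, which cancels the factor 2 per vertex and leaves the
    six-vertex model.

    The square is cut below its central antidiagonal.  Both parts are
    triangles of the same kind, exchanged by the reflection
    [(x, y) -> (n+1-y, n+1-x)] combined with the reversal of all arrows; this
    symmetry also exchanges the two boundary conditions. *)

From Stdlib Require Import FunctionalExtensionality.
Require Import Defs.
From mathcomp Require Import all_boot all_order all_algebra.
From mathcomp Require Import ring zify.

Set Implicit Arguments.
Unset Strict Implicit.
Unset Printing Implicit Defensive.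

Import GRing.Theory Num.Theory.
Local Open Scope ring_scope.

(** * Words and local weights *)

Fixpoint words (k : nat) : seq bitseq :=
  if k is k'.+1 then [seq b :: w | b <- [:: true; false], w <- words k']
  else [:: [::]].

Lemma mem_words k (w : bitseq) : (w \in words k) = (size w == k).
Proof.
elim: k w => [|k IH] [|b w] //=.
  by rewrite !mem_cat; apply/negbTE; rewrite !negb_or; apply/and3P; split => //;
    apply/mapP => -[].
have memb c : (b :: w \in [seq c :: w | w <- words k]) = (b == c) && (size w == k).
  apply/mapP/andP => [[v vk [-> ->]]|[/eqP-> wk]].
    by rewrite eqxx -IH.
  by exists w; rewrite ?IH.
by rewrite !mem_cat !memb eqSS; case: b {memb}; rewrite /= ?orbF.
Qed.

Lemma size_words k : size (words k) = (2 ^ k)%N.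
Proof.
by elim: k => //= k IH; rewrite cats0 size_cat !size_map IH expnS mul2n addnn.
Qed.

Lemma uniq_words k : uniq (words k).
Proof.
elim: k => // k IH; apply: allpairs_uniq => // -[a u] [b v] _ _ /=.
by case=> -> ->.
Qed.

Section WordSums.
Variable R : nmodType.
Implicit Types F : bitseq -> R.

Lemma sum_words0 F : \sum_(w <- words 0) F w = F [::].
Proof. exact: big_seq1. Qed.

Lemma sum_wordsS k F :
  \sum_(w <- words k.+1) F w
    = \sum_(b : bool) \sum_(w <- words k) F (b :: w).
Proof.
by rewrite big_allpairs_dep big_bool big_cons big_seq1.
Qed.

Lemma sum_words_rcons k F :
  \sum_(w <- words k.+1) F w
    = \sum_(b : bool) \sum_(w <- words k) F (rcons w b).
Proof.
elim: k F => [|k IH] F.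
  by rewrite sum_wordsS; apply: eq_bigr => b _; rewrite !sum_words0.
rewrite sum_wordsS; under eq_bigr do rewrite IH.
rewrite exchange_big; apply: eq_bigr => b _.
by rewrite sum_wordsS.
Qed.

Lemma sum_words_cat m k F :
  \sum_(w <- words (m + k)) F w
    = \sum_(u <- words m) \sum_(v <- words k) F (u ++ v).
Proof.
elim: m F => [|m IH] F; first by rewrite sum_words0.
by rewrite addSn !sum_wordsS; apply: eq_bigr => b _; rewrite IH.
Qed.

Lemma eq_sum_words k F1 F2 :
  (forall w, size w = k -> F1 w = F2 w) ->
  \sum_(w <- words k) F1 w = \sum_(w <- words k) F2 w.
Proof.
by move=> eqF; apply: eq_big_seq => w; rewrite mem_words => /eqP /eqF.
Qed.

End WordSums.

Arguments words : simpl never.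

Section Weights.
Variable R : comNzRingType.
Variable s : R.
Hypothesis s2 : s * s = 2.

(* Edges are read in their reference direction (to the east, to the north, to
   the south-east), so a vertical edge is [true] when it is oriented upwards,
   i.e. unoccupied in the sense of the paper.  Hence [h'] (west) and [s']
   (south) enter the vertex, [h] (east) and [v] (north) leave it, and a vertex
   is of type b when its four edges have the same value. *)
Definition w6 (h' s' h v : bool) : R :=
  if (h' + s' == h + v)%N then
    if [&& h' == s', s' == h & h == v] then s else 1
  else 0.

Definition w20 (h' s' d h v d' : bool) : R := ((h' + s' + d == h + v + d')%N)%:R.

(* Crossing of a diagonal line, with values [d] before and [d'] after, and a
   horizontal ([m = false]) or vertical ([m = true]) line with values [b'] on the
   south-west side and [b] on the north-east side.  The type a, with weight
   [s], depends on [m] because of the reading of vertical edges. *)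
Definition wcross (m d b b' d' : bool) : R :=
  if (d + b' == d' + b)%N then
    if (b == b') && ((d == b) (+) m) then s else 1
  else 0.

(** The diagonal crosses the vertical line north of the vertex, then the horizontal line east of it;
    [x], [y] and [c] are the sides of the small triangle so formed. For each of the twenty states
    the sum is either [s * s] or [1 + 1]. *)
Lemma resolve_north_east h' v' d h v e :
  \sum_(x : bool) \sum_(y : bool) \sum_(c : bool)
     wcross true d v x c * wcross false c h y e * w6 h' v' y x
  = 2 * w20 h' v' d h v e.
Proof.
rewrite !big_bool /= /wcross /w6 /w20.
case: h'; case: v'; case: d; case: h; case: v; case: e;
  rewrite /= ?(mul1r, mulr1, mul0r, mulr0, add0r, addr0) ?s2 //;
  by [].
Qed.

Lemma resolve_south_west h' v' d h v e :
  \sum_(x : bool) \sum_(y : bool) \sum_(c : bool)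
     w6 x y h v * (wcross false d x h' c * wcross true c y v' e)
  = 2 * w20 h' v' d h v e.
Proof.
rewrite !big_bool /= /wcross /w6 /w20.
case: h'; case: v'; case: d; case: h; case: v; case: e;
  rewrite /= ?(mul1r, mulr1, mul0r, mulr0, add0r, addr0) ?s2 //;
  by [].
Qed.

End Weights.

(** * Transfer across antidiagonals *)

(* The edges crossed by an antidiagonal staircase, from north-west to
   south-east, form an alternating word.  [line6 u w] is the weight of a row of
   vertices with north-east word [u = v1 h1 v2 h2 ..] and south-west word
   [w = h1' v1' h2' v2' ..]; [line20] sums over the diagonal edges in between,
   [crossing] is the weight of a diagonal line between the words [u] and [w]. *)
Section Kernels.
Variable R : comNzRingType.
Variable s : R.

Fixpoint line6 (u w : bitseq) : R :=
  match u, w with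
  | v :: h :: u', h' :: v' :: w' => w6 s h' v' h v * line6 u' w'
  | [::], [::] => 1
  | _, _ => 0
  end.

Fixpoint line20 (d : bool) (u w : bitseq) (e : bool) : R :=
  match u, w with
  | v :: h :: u', h' :: v' :: w' =>
      \sum_(c : bool) w20 R h' v' d h v c * line20 c u' w' e
  | [::], [::] => (d == e)%:R
  | _, _ => 0
  end.

Fixpoint crossing (m d : bool) (u w : bitseq) (e : bool) : R :=
  match u, w with
  | b :: u', b' :: w' =>
      \sum_(c : bool) wcross s m d b b' c * crossing (~~ m) c u' w' e
  | [::], [::] => (d == e)%:R
  | _, _ => 0
  end.

(* Partition function of the triangle below the antidiagonal with [k] vertices,
   as a function of its north-east word; the two outer letters come from the
   west and south boundaries. *)
Fixpoint triangle_sum (K : bitseq -> bitseq -> R) (k : nat) (u : bitseq) : R :=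
  if k is k'.+1 then
    \sum_(w <- words k'.*2) K u (true :: rcons w false) * triangle_sum K k' w
  else 1.

Hypothesis s2 : s * s = 2.

(** The row is resolved vertex by vertex from the north-west, and each of its [k] vertices
    contributes the 2 of [resolve_north_east]. *)
Lemma crossing_line6 k d u w e :
  size u = k.*2 -> size w = k.*2 ->
  \sum_(x <- words k.*2) crossing true d u x e * line6 x w
    = 2 ^+ k * line20 d u w e.
Proof.
elim: k d u w => [|k IH] d [|v [|h u]] [|h' [|v' w]] //=.
  by rewrite sum_words0 mulr1 expr0 mul1r.
move=> [su] [sw].
(* Here [x], [y], [c] are the inner edges of the first resolved vertex, and [c'] is the value the
   diagonal carries to the next one. *)
transitivity (\sum_(x : bool) \sum_(y : bool) \sum_(c : bool) \sum_(c' : bool)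
    wcross s true d v x c * wcross s false c h y c' * w6 s h' v' y x
      * (2 ^+ k * line20 c' u w e)).
  rewrite doubleS sum_wordsS; apply: eq_bigr => x _.
  rewrite sum_wordsS; apply: eq_bigr => y _ /=.
  under eq_bigr => z _.
    rewrite big_distrl /=; under eq_bigr => c _ do
      rewrite big_distrr big_distrl /=.
    over.
  rewrite exchange_big; apply: eq_bigr => c _.
  rewrite exchange_big; apply: eq_bigr => c' _ /=.
  by rewrite -IH // big_distrr /=; apply: eq_bigr => z _; ring.
transitivity (\sum_(c : bool)
    2 * w20 R h' v' d h v c * (2 ^+ k * line20 c u w e)).
  under [RHS]eq_bigr do rewrite -(resolve_north_east s2).
  by rewrite !big_bool /=; ring.
by rewrite big_distrr /= exprS; apply: eq_bigr => c _; ring.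
Qed.

(** The right-hand side is that of [crossing_line6], so together the two lemmas move a diagonal line
    from one side of a row to the other. *)
Lemma line6_crossing k d u w e :
  size u = k.*2 -> size w = k.*2 ->
  \sum_(x <- words k.*2) line6 u x * crossing false d x w e
    = 2 ^+ k * line20 d u w e.
Proof.
elim: k d u w => [|k IH] d [|v [|h u]] [|h' [|v' w]] //=.
  by rewrite sum_words0 expr0 !mul1r.
move=> [su] [sw].
transitivity (\sum_(x : bool) \sum_(y : bool) \sum_(c : bool) \sum_(c' : bool)
    w6 s x y h v * (wcross s false d x h' c * wcross s true c y v' c')
      * (2 ^+ k * line20 c' u w e)).
  rewrite doubleS sum_wordsS; apply: eq_bigr => x _.
  rewrite sum_wordsS; apply: eq_bigr => y _ /=.
  under eq_bigr => z _.
    rewrite big_distrr /=; under eq_bigr => c _ do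
      rewrite big_distrr big_distrr /=.
    over.
  rewrite exchange_big; apply: eq_bigr => c _.
  rewrite exchange_big; apply: eq_bigr => c' _ /=.
  by rewrite -IH // big_distrr /=; apply: eq_bigr => z _; ring.
transitivity (\sum_(c : bool)
    2 * w20 R h' v' d h v c * (2 ^+ k * line20 c u w e)).
  under [RHS]eq_bigr do rewrite -(resolve_south_west s2).
  by rewrite !big_bool /=; ring.
by rewrite big_distrr /= exprS; apply: eq_bigr => c _; ring.
Qed.

Lemma crossing_rcons m d u b w b' e :
  size u = size w ->
  crossing m d (rcons u b) (rcons w b') e
    = \sum_(c : bool) crossing m d u w c * wcross s (odd (size u) (+) m) c b b' e.
Proof.
elim: u w m d => [|a u IH] [|a' w] m d //=.
  move=> _; rewrite !big_bool /=; case: d; case: e; rewrite /=; ring.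
move=> [suw]; under eq_bigr do rewrite (IH _ _ _ suw) big_distrr /=.
rewrite exchange_big; apply: eq_bigr => c _.
rewrite big_distrl /=; apply: eq_bigr => c' _.
by rewrite mulrA addbN -addNb.
Qed.

(* Conservation leaves a single state for the two outer crossings, each of
   weight [s]. *)
Lemma crossing_frozen k a b x w :
  size x = k.*2 -> size w = k.*2 ->
  crossing false true (a :: rcons x b) (true :: rcons w false) true
    = ([&& a & ~~ b])%:R * (2 * crossing true true x w true).
Proof.
move=> sx sw.
have crs c : crossing true c (rcons x b) (rcons w false) true
    = (~~ b)%:R * s * crossing true c x w true.
  rewrite crossing_rcons ?sx ?sw // odd_double /= big_bool /wcross /=.
  by case: b; rewrite /=; ring.
rewrite /= big_bool /= !crs /wcross -s2.
by clear crs; case: a; case: b; rewrite /=; ring.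
Qed.

(** Freezing fixes the outer letters of [x], which are then the boundary letters that [triangle_sum]
    inserts. *)
Lemma line6_crossing_frozen k u w :
  size w = k.*2 ->
  \sum_(x <- words k.+1.*2)
      line6 u x * crossing false true x (true :: rcons w false) true
    = 2 * \sum_(x <- words k.*2)
        line6 u (true :: rcons x false) * crossing true true x w true.
Proof.
move=> sw; rewrite doubleS sum_wordsS.
under eq_bigr do rewrite sum_words_rcons.
rewrite big_distrr !big_bool -!big_split.
apply: eq_sum_words => x sx.
by rewrite !(crossing_frozen _ _ sx sw) /=; ring.
Qed.

(** With the line south-west of the row, its outer crossings give one factor 2 and the smaller
    triangle absorbs the rest. Absorption is a hypothesis here, so that the step serves both inside
    the induction for [absorb_diagonal] and after it. *)
Lemma absorb_step k u :
  (forall x, size x = k.*2 ->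
    \sum_(w <- words k.*2) crossing true true x w true * triangle_sum line6 k w
      = 2 ^+ k * triangle_sum line6 k x) ->
  \sum_(w <- words k.*2)
      (\sum_(x <- words k.+1.*2)
         line6 u x * crossing false true x (true :: rcons w false) true)
      * triangle_sum line6 k w
    = 2 ^+ k.+1 * triangle_sum line6 k.+1 u.
Proof.
move=> IH.
under eq_sum_words => w sw.
  rewrite line6_crossing_frozen // -mulrA big_distrl /=; over.
rewrite -big_distrr exchange_big exprS -mulrA /= [2 ^+ k * _]big_distrr /=.
congr (_ * _); apply: eq_sum_words => x sx.
rewrite mulrCA -IH // big_distrr /=.
by apply: eq_bigr => w _; ring.
Qed.

Lemma absorb_diagonal k u :
  size u = k.*2 ->
  \sum_(x <- words k.*2) crossing true true u x true * triangle_sum line6 k x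
    = 2 ^+ k * triangle_sum line6 k u.
Proof.
elim: k u => [|k IH] u su.
  by case: u su => // _; rewrite sum_words0 /= expr0 !mulr1.
rewrite -absorb_step //=; under eq_bigr do rewrite big_distrr /=.
rewrite exchange_big; apply: eq_sum_words => w sw.
(* Both resolutions of the outer row are the same multiple of [line20]: this is where the line
   passes through the row. *)
rewrite line6_crossing /= ?size_rcons ?sw //.
rewrite -crossing_line6 /= ?size_rcons ?sw // big_distrl /=.
by apply: eq_bigr => x _; ring.
Qed.

End Kernels.

(** Rows are converted from the south-west corner outwards. When the outer row is resolved, the
    triangle below it is already six-vertex and absorbs the line; the factors [2 ^+ k.+1] of
    resolution and absorption cancel because 2 is nonzero in [R]. *)
Lemma triangle_sum_line20 (R : numDomainType) (s : R) k u :
  s * s = 2 -> size u = k.*2 ->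
  triangle_sum (fun x w => line20 R true x w true) k u = triangle_sum (line6 s) k u.
Proof.
move=> s2; elim: k u => // k IH u su.
have nz : (2 : R) ^+ k.+1 != 0 by rewrite expf_neq0 // pnatr_eq0.
apply: (mulfI nz); rewrite -(absorb_step s2 u (absorb_diagonal s2 (k := k))) //.
rewrite /= big_distrr /=; apply: eq_sum_words => w sw.
by rewrite mulrA IH // line6_crossing //= ?size_rcons ?sw.
Qed.

(** * Sums over edge assignments *)

Section Assignments.
Variables (T : eqType) (R : pzSemiRingType).
Implicit Types (E : seq T) (f g : T -> bool) (w : bitseq) (G : (T -> bool) -> R).

(* For [e] outside [E] the index is [size E], where [nth] gives the default
   [f e]. *)
Definition extend E w f : T -> bool := fun e => nth (f e) w (index e E).

Definition state_sum E f G : R := \sum_(w <- words (size E)) G (extend E w f).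

Lemma extend_notin E w f e : size w = size E -> e \notin E -> extend E w f e = f e.
Proof.
by move=> sw eE; rewrite /extend nth_default // sw leqNgt index_mem.
Qed.

Lemma map_extend E w f : uniq E -> size w = size E -> map (extend E w f) E = w.
Proof.
move=> uE sw; apply: (@eq_from_nth _ false); rewrite size_map // => i iE.
case: E uE sw iE => // e0 E uE sw iE.
by rewrite (nth_map e0) // /extend index_uniq //; apply: set_nth_default;
  rewrite sw.
Qed.

Lemma extend_map E f g :
  (forall e, e \notin E -> g e = f e) -> extend E (map g E) f = g.
Proof.
move=> gf; apply: functional_extensionality => e; rewrite /extend.
have [eE|eE] := boolP (e \in E).
  by rewrite (nth_map e) ?index_mem // nth_index.
by rewrite nth_default ?gf // size_map leqNgt index_mem.
Qed.

Lemma state_sum0 f G : state_sum [::] f G = G f.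
Proof. exact: big_seq1. Qed.

Lemma eq_state_sum E f G1 G2 :
  (forall g, (forall e, e \notin E -> g e = f e) -> G1 g = G2 g) ->
  state_sum E f G1 = state_sum E f G2.
Proof.
by move=> eqG; apply: eq_sum_words => w sw; apply: eqG => e; apply: extend_notin.
Qed.

Lemma state_sum_mull E f G1 G2 :
  (forall g, (forall e, e \notin E -> g e = f e) -> G1 g = G1 f) ->
  state_sum E f (fun g => G1 g * G2 g) = G1 f * state_sum E f G2.
Proof.
move=> G1E; rewrite /state_sum big_distrr /=; apply: eq_sum_words => w sw.
by rewrite G1E // => e; apply: extend_notin.
Qed.

Lemma state_sum_map E f F : uniq E ->
  state_sum E f (fun g => F (map g E)) = \sum_(w <- words (size E)) F w.
Proof. by move=> uE; apply: eq_sum_words => w sw; rewrite map_extend. Qed.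

Lemma state_sum_cat E1 E2 f G : uniq (E1 ++ E2) ->
  state_sum (E1 ++ E2) f G = state_sum E1 f (fun g => state_sum E2 g G).
Proof.
rewrite cat_uniq => /and3P[_ /hasPn dis _].
rewrite /state_sum size_cat sum_words_cat.
apply: eq_sum_words => u su; apply: eq_sum_words => v sv; congr G.
apply: functional_extensionality => e.
rewrite /extend index_cat nth_cat su; have [eE|eE] := boolP (e \in E1).
  rewrite index_mem eE [RHS]nth_default //.
  by rewrite sv leqNgt index_mem; apply/negP => /dis; rewrite /= eE.
rewrite ltnNge leq_addr addKn /=; congr nth.
by rewrite nth_default // su leqNgt index_mem.
Qed.

(** An injection between sets of the same size is a bijection, so no inverse of [phi] has to be
    built. *)
Lemma perm_map_words (I : eqType) (r : seq I) (phi : I -> bitseq) k :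
  uniq r -> size r = (2 ^ k)%N -> {in r &, injective phi} ->
  (forall i, i \in r -> size (phi i) = k) -> perm_eq (map phi r) (words k).
Proof.
move=> ur sr injphi sphi.
have um : uniq (map phi r) by rewrite map_inj_in_uniq.
have sub : {subset map phi r <= words k}.
  by move=> _ /mapP[i ir ->]; rewrite mem_words sphi.
apply: uniq_perm; rewrite ?uniq_words //.
by case: (uniq_min_size um sub); rewrite ?size_words ?size_map ?sr.
Qed.

(** The last condition says that [t] carries the fixed values [f1] to [f2]. Injectivity of [t] then
    descends to the words, which determine the assignments, and counting does the rest. *)
Lemma state_sum_reindex E1 E2 f1 f2 (t : (T -> bool) -> T -> bool) G :
  uniq E1 -> size E1 = size E2 -> injective t ->
  (forall g, (forall e, e \notin E1 -> g e = f1 e) ->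
     forall e, e \notin E2 -> t g e = f2 e) ->
  state_sum E1 f1 (fun g => G (t g)) = state_sum E2 f2 G.
Proof.
move=> u1 s12 tinj tE.
pose phi w := map (t (extend E1 w f1)) E2.
have phiK w : size w = size E1 ->
    t (extend E1 w f1) = extend E2 (phi w) f2.
  by move=> sw; rewrite extend_map //; apply: tE => e; apply: extend_notin.
rewrite /state_sum.
have /(perm_big _) <- /= : perm_eq (map phi (words (size E1))) (words (size E2)).
  apply: perm_map_words; rewrite ?uniq_words ?size_words ?s12 //.
    move=> w w'; rewrite !mem_words -s12 => /eqP sw /eqP sw' eqphi.
    rewrite -(map_extend f1 u1 sw) -(map_extend f1 u1 sw').
    by congr map; apply: tinj; rewrite !phiK // eqphi.
  by move=> w _; rewrite size_map.
by rewrite big_map; apply: eq_sum_words => w sw; rewrite phiK.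
Qed.

Lemma state_sum_perm E1 E2 f G : uniq E1 -> perm_eq E1 E2 ->
  state_sum E1 f G = state_sum E2 f G.
Proof.
move=> u1 p12; apply: (state_sum_reindex (t := id)) => //; first exact: perm_size.
by move=> g gf e eE; apply: gf; rewrite (perm_mem p12).
Qed.

End Assignments.

(** * Orientations as Boolean assignments *)

Definition orient (f : dedge -> bool) (e : dedge) : dedge :=
  if f e then e else rev_dedge e.

Section Orientations.
Variables (R : pzSemiRingType) (E : seq dedge) (uE : uniq E).

Definition assignment (f : dedge -> bool) (o : orientation E) : dedge -> bool :=
  fun e => oapp o (f e) (insub e).

Lemma assignment_val f o (e : seq_sub E) : assignment f o (ssval e) = o e.
Proof. by rewrite /assignment -[ssval e]/(val e) valK. Qed.

Lemma assignment_notin f o e : e \notin E -> assignment f o e = f e.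
Proof. by move=> eE; rewrite /assignment insubN. Qed.

Lemma sum_orientations f (G : (dedge -> bool) -> R) :
  \sum_(o : orientation E) G (assignment f o) = state_sum E f G.
Proof.
pose phi o := map (assignment f o) E.
rewrite /state_sum.
have /(perm_big _) <- /= :
    perm_eq (map phi (index_enum {: orientation E})) (words (size E)).
  apply: perm_map_words.
  - exact: index_enum_uniq.
  - by rewrite -[index_enum _]enumT -cardT card_ffun card_bool card_seq_sub.
  - move=> o o' _ _ /eq_in_map eqo; apply/ffunP => e.
    by rewrite -!(assignment_val f) eqo ?ssvalP.
  - by move=> o _; rewrite size_map.
rewrite big_map; apply: eq_bigr => o _; rewrite extend_map // => e.
exact: assignment_notin.
Qed.

Lemma perm_arcs_of f (o : orientation E) :
  perm_eq (arcs_of o)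
    (map (orient (assignment f o)) E).
Proof.
rewrite /arcs_of.
have -> : [seq if o e then ssval e else rev_dedge (ssval e)
             | e <- enum {: seq_sub E}]
    = map (orient (assignment f o)) (map (@ssval _ E) (enum {: seq_sub E})).
  by rewrite -[RHS]map_comp; apply: eq_map => e; rewrite /= /orient assignment_val.
apply: perm_map; apply: uniq_perm => //.
  by rewrite map_inj_uniq ?enum_uniq //; apply: val_inj.
move=> e; apply/mapP/idP => [[e' _ ->]|eE]; first exact: ssvalP.
by exists (SeqSub eE); rewrite ?mem_enum.
Qed.

End Orientations.

(** * Edges and vertices along antidiagonals *)

Definition horiz (x y : nat) : dedge := ((x, y), (x.+1, y)).
Definition vert (x y : nat) : dedge := ((x, y), (x, y.+1)).
Definition diag (x y : nat) : dedge := ((x, y.+1), (x.+1, y)).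

Definition is_horiz (e : dedge) := e == horiz e.1.1 e.1.2.
Definition is_vert (e : dedge) := e == vert e.1.1 e.1.2.
Definition is_diag (e : dedge) := e == diag e.1.1 e.2.2.

(* A horizontal or vertical edge has odd level and a diagonal edge has even
   level; the edges at a vertex [v] have level [2 (v.1 + v.2)], plus or minus 1. *)
Definition level (e : dedge) : nat := (e.1.1 + e.1.2 + e.2.1 + e.2.2)%N.
Definition positive (e : dedge) :=
  [&& 0 < e.1.1, 0 < e.1.2, 0 < e.2.1 & 0 < e.2.2]%N.

(** The row consists of the [m] vertices from [(x.+1, m)] down to [(x + m, 1)]; the order of the
    edges is the one read by [line6]. The offset [x] is there for inductions that remove the first
    vertex. *)
Fixpoint north_east (x m : nat) : seq dedge :=
  if m is m'.+1 then vert x.+1 m :: horiz x.+1 m :: north_east x.+1 m'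
  else [::].
Fixpoint south_west (x m : nat) : seq dedge :=
  if m is m'.+1 then horiz x m :: vert x.+1 m' :: south_west x.+1 m'
  else [::].
Fixpoint antidiag (x m : nat) : seq point :=
  if m is m'.+1 then (x.+1, m) :: antidiag x.+1 m' else [::].
Fixpoint inner_diag (x m : nat) : seq dedge :=
  if m is m'.+1 then diag x.+1 m :: inner_diag x.+1 m' else [::].

Definition line_diag (dg : bool) (k : nat) := if dg then inner_diag 0 k else [::].

(** The north-east edges of the outermost row are left out: their values are the argument of
    [triangle_sum]. *)
Fixpoint triangle_edges (dg : bool) (k : nat) : seq dedge :=
  if k is k'.+1 then
    north_east 0 k' ++ line_diag dg k' ++ triangle_edges dg k'
  else [::].
Fixpoint triangle (k : nat) : seq point :=
  if k is k'.+1 then antidiag 0 k ++ triangle k' else [::].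

Lemma size_north_east x m : size (north_east x m) = m.*2.
Proof. by elim: m x => //= m IH x; rewrite IH doubleS. Qed.

(** Consecutive rows share a staircase. For [x = 0] the two additional edges lie on the west and
    south boundaries. *)
Lemma south_westE x m :
  south_west x m.+1 = horiz x m.+1 :: rcons (north_east x m) (vert (x + m).+1 0).
Proof.
elim: m x => [|m IH] x; first by rewrite addn0.
by rewrite [LHS]/= -/(south_west x.+1 m.+1) IH addSnnS.
Qed.

Lemma mem_north_east x m e :
  (e \in north_east x m) = [&& is_horiz e || is_vert e, x < e.1.1, 0 < e.1.2
    & e.1.1 + e.1.2 == (x + m).+1]%N.
Proof.
case: e => [[a b] [c d]].
elim: m x => [|m IH] x;
  rewrite /= ?in_nil ?inE ?IH /is_horiz /is_vert /= ?xpair_eqE; lia.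
Qed.

Lemma mem_inner_diag x m e :
  (e \in inner_diag x m) = [&& is_diag e, x < e.1.1, 0 < e.2.2
    & e.1.1 + e.2.2 == (x + m).+1]%N.
Proof.
case: e => [[a b] [c d]].
elim: m x => [|m IH] x; rewrite /= ?in_nil ?inE ?IH /is_diag /= ?xpair_eqE; lia.
Qed.

Lemma mem_antidiag x m v :
  (v \in antidiag x m) = [&& x < v.1, 0 < v.2 & v.1 + v.2 == (x + m).+1]%N.
Proof.
case: v => [a b].
elim: m x => [|m IH] x; rewrite /= ?in_nil ?inE ?IH /= ?xpair_eqE; lia.
Qed.

Lemma mem_line_diag dg k e :
  (e \in line_diag dg k)
    = [&& dg, is_diag e, 0 < e.1.1, 0 < e.2.2 & e.1.1 + e.2.2 == k.+1]%N.
Proof. by case: dg => //=; rewrite mem_inner_diag. Qed.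

Lemma mem_triangle_edges dg k e :
  (e \in triangle_edges dg k)
    = [&& [|| is_horiz e, is_vert e | dg && is_diag e], positive e
        & level e <= k.*2.+2]%N.
Proof.
elim: k => [|k IH] /=; last first.
  rewrite !mem_cat IH mem_north_east mem_line_diag.
  case: e {IH} => [[a b] [c d]].
  rewrite /is_diag /is_horiz /is_vert /positive /level /= ?xpair_eqE; lia.
case: e => [[a b] [c d]].
rewrite /is_diag /is_horiz /is_vert /positive /level /= ?xpair_eqE in_nil; lia.
Qed.

Lemma triangleS k : triangle k.+1 = antidiag 0 k.+1 ++ triangle k.
Proof. by []. Qed.

Lemma mem_triangle k v :
  (v \in triangle k) = [&& 0 < v.1, 0 < v.2 & v.1 + v.2 <= k.+1]%N.
Proof.
elim: k => [|k IH]; first by rewrite in_nil; lia.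
by rewrite triangleS mem_cat IH mem_antidiag; lia.
Qed.

Lemma uniq_north_east x m : uniq (north_east x m).
Proof.
elim: m x => //= m IH x.
rewrite IH !inE !mem_north_east /is_horiz /is_vert /= ?xpair_eqE; lia.
Qed.

Lemma uniq_inner_diag x m : uniq (inner_diag x m).
Proof.
elim: m x => //= m IH x.
rewrite IH mem_inner_diag /is_diag /= ?xpair_eqE; lia.
Qed.

Lemma uniq_antidiag x m : uniq (antidiag x m).
Proof. elim: m x => //= m IH x; rewrite IH mem_antidiag /=; lia. Qed.

Lemma uniq_line_diag dg k : uniq (line_diag dg k).
Proof. by case: dg => //; apply: uniq_inner_diag. Qed.

Lemma uniq_triangle_edges dg k : uniq (triangle_edges dg k).
Proof.
elim: k => //= k IH.
rewrite !cat_uniq IH uniq_north_east uniq_line_diag /= andbT.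
apply/andP; split; apply/hasPn => -[[a b] [c d]];
  rewrite ?mem_cat mem_triangle_edges mem_line_diag ?mem_north_east
    /is_diag /is_horiz /is_vert /positive /level /= ?xpair_eqE; lia.
Qed.

Lemma uniq_triangle k : uniq (triangle k).
Proof.
elim: k => // k IH; rewrite triangleS cat_uniq IH uniq_antidiag andbT.
by apply/hasPn => v; rewrite mem_triangle mem_antidiag; lia.
Qed.

(** * Triangles *)

(** The west and south boundary values along the first [k] rows, with both ends of every diagonal
    line oriented to the south-east. *)
Definition wired (k : nat) (f : dedge -> bool) :=
  forall m, (0 < m <= k)%N ->
    [/\ f (horiz 0 m), ~~ f (vert m 0), f (diag 0 m) & f (diag m 0)].

Lemma wired_eq k f g :
  (forall e, ~~ positive e -> g e = f e) -> wired k f -> wired k g.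
Proof.
move=> gf wf m /wf[h v d d'].
by split; rewrite gf // /positive /= ?andbF.
Qed.

Lemma wired_leq j k f : (j <= k)%N -> wired k f -> wired j f.
Proof. by move=> jk wf m mj; apply: wf; lia. Qed.

Section Model.
Variables (R : comNzRingType) (dg : bool).
Variable wt : (dedge -> bool) -> point -> R.
Variable K : bitseq -> bitseq -> R.

(** Dependence is restricted by level only, not to the edges at [v]; this suffices to separate the
    rows. *)
Definition local_weight :=
  forall v f g, (0 < v.1)%N -> (0 < v.2)%N ->
    (forall e, ((v.1 + v.2).*2 <= (level e).+1 <= (v.1 + v.2).+1.*2)%N -> f e = g
      e) ->
  wt f v = wt g v.

Definition line_kernel :=
  forall k f, wired k.+1 f ->
    state_sum (line_diag dg k) f (fun g => \prod_(v <- antidiag 0 k.+1) wt g v)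
      = K (map f (north_east 0 k.+1)) (map f (south_west 0 k.+1)).

Hypotheses (wt_local : local_weight) (lineK : line_kernel).

(** Once the staircase below the outer row is fixed, the smaller triangle and the diagonals of the
    outer row are summed independently. *)
Lemma state_sum_triangle k f : wired k f ->
  state_sum (triangle_edges dg k) f (fun g => \prod_(v <- triangle k) wt g v)
    = triangle_sum K k (map f (north_east 0 k)).
Proof.
elim: k f => [|k IH] f wf; first by rewrite state_sum0 big_nil.
have pos e : e \in triangle_edges dg k.+1 -> positive e.
  by rewrite mem_triangle_edges => /and3P[].
have ue := uniq_triangle_edges dg k.+1.
have memS e : e \in triangle_edges dg k.+1 =
   [|| e \in north_east 0 k, e \in line_diag dg k | e \in triangle_edges dg k].
  by rewrite /= !mem_cat.
rewrite [triangle_edges _ _]/= in ue *; rewrite state_sum_cat // [RHS]/=.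
move: (ue); rewrite cat_uniq => /and3P[une _ ue'].
rewrite -(size_north_east 0 k) -(state_sum_map f _ une).
apply: eq_state_sum => g gf; rewrite state_sum_cat //.
have wg : wired k.+1 g.
  apply: wired_eq wf => e npe; apply: gf; apply: contra npe => ee.
  by apply: pos; rewrite memS ee.
transitivity (state_sum (line_diag dg k) g (fun g' =>
    triangle_sum K k (map g (north_east 0 k)) * \prod_(v <- antidiag 0 k.+1) wt
      g' v)).
  apply: eq_state_sum => g' g'g; under eq_state_sum do rewrite triangleS big_cat.
  rewrite state_sum_mull; last first.
    move=> h hg'; apply: eq_big_seq => -[x y]; rewrite mem_antidiag /= => vl.
    apply: wt_local => /=; [lia..|] => e le; apply: hg'.
    by rewrite mem_triangle_edges; lia.
  rewrite IH; last first.
    apply: wired_leq (leqnSn k) _; apply: wired_eq wg => e npe; apply: g'g.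
    by apply: contra npe => ee; apply: pos; rewrite memS ee orbT.
  rewrite mulrC; congr (triangle_sum K k _ * _).
  apply/eq_in_map => e; rewrite mem_north_east => ne; apply: g'g.
  rewrite mem_line_diag; apply: contraL ne; case: e => [[a b] [c d]].
  by rewrite /is_diag /is_horiz /is_vert /= ?xpair_eqE; lia.
rewrite state_sum_mull // lineK // mulrC south_westE.
have -> : map g (north_east 0 k.+1) = map f (north_east 0 k.+1).
  apply/eq_in_map => e; rewrite mem_north_east => ne; apply: gf.
  by rewrite mem_north_east; lia.
rewrite /= -/(map g (rcons _ _)) map_rcons.
(* The outer letters of the south-west word are the wired values [true] and [false]. *)
case: (wg k.+1) => [|-> /negbTE]; first by lia.
by rewrite add0n => -> _ _.
Qed.

End Model.

(** * Local weights of the two models and their row kernels *)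

Definition east (v : point) : dedge := horiz v.1 v.2.
Definition north (v : point) : dedge := vert v.1 v.2.
Definition west (v : point) : dedge := horiz v.1.-1 v.2.
Definition south (v : point) : dedge := vert v.1 v.2.-1.
Definition northwest (v : point) : dedge := diag v.1.-1 v.2.
Definition southeast (v : point) : dedge := diag v.1 v.2.-1.

Section Weights.
Variables (R : comNzRingType) (s : R).

Definition wt6 (f : dedge -> bool) (v : point) : R :=
  w6 s (f (west v)) (f (south v)) (f (east v)) (f (north v)).

Definition wt20 (f : dedge -> bool) (v : point) : R :=
  w20 R (f (west v)) (f (south v)) (f (northwest v))
    (f (east v)) (f (north v)) (f (southeast v)).

Lemma wt6_local : local_weight wt6.
Proof.
move=> [x y] f g /= x0 y0 fg.
by rewrite /wt6; congr w6; apply: fg; rewrite /level /=; lia.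
Qed.

Lemma wt20_local : local_weight wt20.
Proof.
move=> [x y] f g /= x0 y0 fg.
by rewrite /wt20; congr w20; apply: fg; rewrite /level /=; lia.
Qed.

Lemma line6_kernel : line_kernel false wt6 (line6 s).
Proof.
move=> k f _; rewrite state_sum0; move: 0%N (k.+1) => x m.
by elim: m x => [|m IH] x; rewrite ?big_nil // big_cons IH.
Qed.

Lemma sum_inner_diag x k f :
  state_sum (inner_diag x k) f (fun g => \prod_(v <- antidiag x k.+1) wt20 g v)
    = line20 R (f (diag x k.+1)) (map f (north_east x k.+1))
        (map f (south_west x k.+1)) (f (diag (x + k).+1 0)).
Proof.
elim: k x f => [|k IH] x f.
  rewrite state_sum0 big_seq1 addn0 /= big_bool /wt20 /=.
  by case: (f (diag _ 0)); rewrite ?mulr1 ?mulr0 ?addr0 ?add0r.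
have ud : uniq ([:: diag x.+1 k.+1] ++ inner_diag x.+1 k).
  exact: (uniq_inner_diag x k.+1).
rewrite -[inner_diag x k.+1]/([:: diag x.+1 k.+1] ++ inner_diag x.+1 k).
(* The single letter of [w] is the value on the first inner diagonal, the variable [c] summed in
   [line20]. *)
pose F (w : bitseq) := w20 R (f (horiz x k.+2)) (f (vert x.+1 k.+1))
    (f (diag x k.+2)) (f (horiz x.+1 k.+2)) (f (vert x.+1 k.+2)) (nth false w 0)
  * line20 R (nth false w 0) (map f (north_east x.+1 k.+1))
      (map f (south_west x.+1 k.+1)) (f (diag (x + k.+1).+1 0)).
rewrite state_sum_cat //.
transitivity (state_sum [:: diag x.+1 k.+1] f
    (fun g => F (map g [:: diag x.+1 k.+1]))); last first.
  by rewrite state_sum_map // sum_wordsS; apply: eq_bigr => b _; rewrite sum_words0.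
apply: eq_state_sum => g gf.
have gfd e : e != diag x.+1 k.+1 -> g e = f e by move=> ne; apply: gf; rewrite inE.
have gfhv e : is_horiz e || is_vert e -> g e = f e.
  case: e => [[a b] [c d]] hv; apply: gfd; move: hv.
  by rewrite /is_horiz /is_vert ?xpair_eqE /= ; lia.
under eq_state_sum => g' g'g.
  rewrite -[antidiag x k.+2]/((x.+1, k.+2) :: antidiag x.+1 k.+1) big_cons; over.
rewrite state_sum_mull; last first.
  move=> h hg; rewrite /wt20 /=.
  by congr w20; apply: hg; rewrite mem_inner_diag /is_diag ?xpair_eqE /=; lia.
rewrite IH /F -addSnnS; congr (_ * _).
  rewrite /wt20 /west /south /east /north /northwest.
  congr w20; first [by [] | by apply: gfhv; rewrite /is_horiz /is_vert /= eqxx ?orbT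
    | by apply: gfd; rewrite /diag !xpair_eqE /=; lia].
congr (line20 _ _ _ _ _).
- apply/eq_in_map => e; rewrite mem_north_east => /andP[hv _]; exact: gfhv.
- apply/eq_in_map => e; rewrite south_westE inE mem_rcons inE mem_north_east.
  case/or3P => [/eqP->|/eqP->|/andP[hv _]]; apply: gfhv => //;
  by rewrite /is_horiz /is_vert /= ?eqxx ?orbT.
- by apply: gfd; rewrite !xpair_eqE; lia.
Qed.

Lemma line20_kernel : line_kernel true wt20 (fun u w => line20 R true u w true).
Proof.
move=> k f wf; rewrite [LHS](sum_inner_diag 0 k f) add0n.
by case: (wf k.+1) => [|_ _ -> ->]; first by lia.
Qed.

End Weights.

(** * Gluing two triangles into a square *)

Arguments triangle_edges : simpl never.

(* Off the grid [flip] is the identity, which makes it, and the reflections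
   built from it, globally involutive. *)
Definition flip (n z : nat) : nat := if (z <= n.+1)%N then (n.+1 - z)%N else z.

Definition reflect_point (n : nat) (v : point) : point := (flip n v.2, flip n v.1).

(* Unlike [is_diag], this is invariant under [reflect_edge] for all edges, on or
   off the grid. *)
Definition slanted (e : dedge) := (e.1.1 != e.2.1) && (e.1.2 != e.2.2).

Definition reflect_edge (n : nat) (e : dedge) : dedge :=
  if slanted e then (reflect_point n e.1, reflect_point n e.2)
  else (reflect_point n e.2, reflect_point n e.1).

(* The reflection preserves the reference direction of diagonals and reverses
   that of the other edges, so reversing all arrows negates the diagonals
   only. *)
Definition reflect_assignment (n : nat) (f : dedge -> bool) (e : dedge) : bool :=
  slanted e (+) f (reflect_edge n e).

Definition bounded (n : nat) (e : dedge) :=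
  [&& e.1.1 <= n.+1, e.1.2 <= n.+1, e.2.1 <= n.+1 & e.2.2 <= n.+1]%N.

Definition inside (n : nat) (e : dedge) :=
  positive e && [&& e.1.1 <= n, e.1.2 <= n, e.2.1 <= n & e.2.2 <= n]%N.

Lemma flipK n : involutive (flip n).
Proof.
by move=> z; rewrite /flip; case: (leqP z n.+1) => h;
  rewrite ?leq_subr ?subKn // leqNgt h.
Qed.

Lemma flip_inj n : injective (flip n).
Proof. exact: can_inj (flipK n). Qed.

Lemma flipE n z : (z <= n.+1)%N -> flip n z = (n.+1 - z)%N.
Proof. by rewrite /flip => ->. Qed.

Lemma reflect_pointK n : involutive (reflect_point n).
Proof. by case=> x y; rewrite /reflect_point /= !flipK. Qed.

Lemma slanted_reflect n e : slanted (reflect_edge n e) = slanted e.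
Proof.
rewrite /reflect_edge -[in RHS]/(slanted e).
by case: ifP => <-; rewrite /slanted /= !(inj_eq (@flip_inj n)) andbC //
  eq_sym [X in _ && ~~ X]eq_sym.
Qed.

Lemma reflect_edgeK n : involutive (reflect_edge n).
Proof.
move=> e; move: (slanted_reflect n e); rewrite /reflect_edge.
by case: ifP => _ ->; rewrite /= !reflect_pointK -surjective_pairing.
Qed.

Lemma reflect_assignmentK n : involutive (reflect_assignment n).
Proof.
move=> f; apply: functional_extensionality => e.
by rewrite /reflect_assignment slanted_reflect reflect_edgeK addKb.
Qed.

Lemma mem_map_reflect n (E : seq dedge) e :
  (e \in map (reflect_edge n) E) = (reflect_edge n e \in E).
Proof.
by rewrite -{1}[e](reflect_edgeK n) mem_map //; apply: can_inj (@reflect_edgeK n).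
Qed.

Section Bounded.
Variables (n : nat) (e : dedge).
Hypothesis be : bounded n e.

Lemma reflect_edgeE : reflect_edge n e =
  if slanted e then
    ((n.+1 - e.1.2, n.+1 - e.1.1), (n.+1 - e.2.2, n.+1 - e.2.1))%N
  else ((n.+1 - e.2.2, n.+1 - e.2.1), (n.+1 - e.1.2, n.+1 - e.1.1))%N.
Proof.
by move: be; case/and4P => *; rewrite /reflect_edge /reflect_point !flipE.
Qed.

Lemma level_reflect : (level (reflect_edge n e) + level e = n.+1.*2.*2)%N.
Proof.
by move: be; rewrite reflect_edgeE /bounded /level; case: ifP => _ /=; lia.
Qed.

Lemma horiz_reflect : is_horiz (reflect_edge n e) = is_vert e.
Proof.
move: be; rewrite reflect_edgeE /bounded /slanted; case: e => [[a b] [c d]].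
by case: ifP; rewrite /is_horiz /is_vert ?xpair_eqE /=; lia.
Qed.

Lemma vert_reflect : is_vert (reflect_edge n e) = is_horiz e.
Proof.
move: be; rewrite reflect_edgeE /bounded /slanted; case: e => [[a b] [c d]].
by case: ifP; rewrite /is_horiz /is_vert ?xpair_eqE /=; lia.
Qed.

Lemma diag_reflect : is_diag (reflect_edge n e) = is_diag e.
Proof.
move: be; rewrite reflect_edgeE /bounded /slanted; case: e => [[a b] [c d]].
by case: ifP; rewrite /is_diag ?xpair_eqE /=; lia.
Qed.

Lemma inside_reflect : inside n (reflect_edge n e) = inside n e.
Proof.
move: be; rewrite reflect_edgeE /bounded /inside /positive;
  case: e => [[a b] [c d]].
by case: ifP => _ /=; lia.
Qed.

End Bounded.

Lemma inside_bounded n e : inside n e -> bounded n e.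
Proof. by rewrite /inside /bounded /positive; lia. Qed.

Lemma reflect_inside n e : inside n (reflect_edge n e) = inside n e.
Proof.
apply/idP/idP => ie; last by rewrite inside_reflect ?inside_bounded.
by rewrite -[e](reflect_edgeK n) inside_reflect // inside_bounded.
Qed.

Lemma triangle_edges_inside dg k n e : (k <= n)%N ->
  e \in triangle_edges dg k -> inside n e.
Proof.
rewrite mem_triangle_edges; case: e => [[a b] [c d]].
by rewrite /is_diag /is_horiz /is_vert /inside /positive /level /= !xpair_eqE; lia.
Qed.

Lemma north_east_inside k n e : (k < n)%N ->
  e \in north_east 0 k -> inside n e.
Proof.
rewrite mem_north_east; case: e => [[a b] [c d]].
by rewrite /is_diag /is_horiz /is_vert /inside /positive /level /= !xpair_eqE; lia.
Qed.

(** In the square of side [n.+1], the staircase above the central antidiagonal is shared by the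
    lower triangle and the reflected upper one; only its two ends are boundary edges. *)
Lemma north_eastE n :
  north_east 0 n.+1
    = vert 1 n.+1
        :: rcons (map (reflect_edge n.+1) (north_east 0 n)) (horiz n.+1 1).
Proof.
suff gen x m : (x + m = n)%N -> north_east x m.+1
    = vert x.+1 m.+1
        :: rcons (map (reflect_edge n.+1) (north_east x m)) (horiz n.+1 1).
  exact: gen.
elim: m x => [|m IH] x xm; first by rewrite /= -xm addn0.
rewrite -[LHS]/(vert x.+1 m.+2 :: horiz x.+1 m.+2 :: north_east x.+1 m.+1).
rewrite IH ?addSnnS // [RHS]/=.
rewrite !reflect_edgeE /slanted /bounded /=; try lia.
rewrite !eqxx andbF /=; congr [:: _, _, _ & _]; rewrite /horiz /vert;
  by congr ((_, _), (_, _)); lia.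
Qed.

Lemma mem_north_east0 m e :
  (e \in north_east 0 m)
    = [&& is_horiz e || is_vert e, positive e & level e == m.*2 + 3]%N.
Proof.
rewrite mem_north_east; case: e => [[a b] [c d]].
by rewrite /is_horiz /is_vert /positive /level /= !xpair_eqE; lia.
Qed.

Definition square_edges (dg : bool) (n : nat) : seq dedge :=
  map (reflect_edge n.+1) (north_east 0 n) ++
  triangle_edges dg n.+1 ++ map (reflect_edge n.+1) (triangle_edges dg n).

Definition square (n : nat) : seq point :=
  triangle n.+1 ++ map (reflect_point n.+1) (triangle n).

(** The level decides the piece: at most [2n+4] in the lower triangle, [2n+5] on the staircase, at
    least [2n+6] in the upper triangle. Diagonals have even level and so avoid the staircase. *)
Lemma mem_square_edges dg n e :
  (e \in square_edges dg n)
    = [|| is_horiz e, is_vert e | dg && is_diag e] && inside n.+1 e.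
Proof.
rewrite /square_edges 2!mem_cat !mem_map_reflect.
have [ie|nie] := boolP (inside n.+1 e); last first.
  rewrite andbF; apply/negbTE; apply: contra nie.
  case/or3P => [/north_east_inside|/triangle_edges_inside|/triangle_edges_inside]
    ie.
  - by rewrite -(reflect_inside n.+1 e) ie.
  - by rewrite ie.
  - by rewrite -(reflect_inside n.+1 e) ie.
have be := inside_bounded ie; have le := level_reflect be.
have ie' : inside n.+1 (reflect_edge n.+1 e) by rewrite reflect_inside.
have de : is_diag e -> level e = (e.1.1 + e.2.2).+1.*2.
  by move/eqP->; rewrite /level /=; lia.
rewrite mem_north_east0 !mem_triangle_edges horiz_reflect // vert_reflect //.
rewrite diag_reflect //; move: ie ie' => /andP[-> _] /andP[-> _].
by case: dg; move: de le; case: (is_diag e) => [/(_ isT)|_]; lia.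
Qed.

Lemma uniq_square_edges dg n : uniq (square_edges dg n).
Proof.
rewrite /square_edges 2!cat_uniq.
rewrite !(map_inj_uniq (can_inj (@reflect_edgeK n.+1))).
rewrite uniq_north_east !uniq_triangle_edges /= andbT.
apply/andP; split; apply/hasPn => e.
  rewrite mem_cat !mem_map_reflect => et.
  have be : bounded n.+1 e.
    apply: inside_bounded; case/orP: et => /triangle_edges_inside ie.
      by rewrite ie.
    by rewrite -(reflect_inside n.+1 e) ie.
  have le := level_reflect be; move: et.
  by rewrite mem_north_east0 !mem_triangle_edges; lia.
rewrite !mem_map_reflect => et.
have /level_reflect le : bounded n.+1 e.
  apply: inside_bounded; rewrite -(reflect_inside n.+1 e).
  by apply: triangle_edges_inside et.
by move: et; rewrite !mem_triangle_edges; lia.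
Qed.

Lemma mem_square n v :
  (v \in square n) = (0 < v.1 <= n.+1)%N && (0 < v.2 <= n.+1)%N.
Proof.
rewrite /square mem_cat -{2}[v](reflect_pointK n.+1).
rewrite mem_map; last exact: can_inj (@reflect_pointK n.+1).
rewrite !mem_triangle; case: v => x y; rewrite /reflect_point /flip /=.
by case: (leqP x n.+2) => hx; case: (leqP y n.+2) => hy; lia.
Qed.

Lemma uniq_square n : uniq (square n).
Proof.
rewrite cat_uniq (map_inj_uniq (can_inj (@reflect_pointK n.+1))) !uniq_triangle
  andbT.
apply/hasPn => _ /mapP[[x y] + ->]; rewrite !mem_triangle /= => xy.
by rewrite !flipE; lia.
Qed.

Section Square.
Variables (R : comNzRingType) (dg : bool).
Variable wt : (dedge -> bool) -> point -> R.
Variable K : bitseq -> bitseq -> R.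
Hypotheses (wt_local : local_weight wt) (lineK : line_kernel dg wt K).
Hypothesis wt_reflect : forall n g v,
  (0 < v.1 <= n)%N -> (0 < v.2 <= n)%N ->
  wt g (reflect_point n v) = wt (reflect_assignment n g) v.

(** For fixed staircase values [w] the two triangles decouple, and reflection with arrow reversal
    turns the upper one into a lower one. The upper triangle has only [n] rows, so the corner
    diagonals belong to the lower one. *)
Lemma state_sum_square_edges n f :
  wired n.+1 f -> wired n (reflect_assignment n.+1 f) ->
  f (vert 1 n.+1) -> ~~ f (horiz n.+1 1) ->
  state_sum (square_edges dg n) f (fun g => \prod_(v <- square n) wt g v)
    = \sum_(w <- words n.*2)
        triangle_sum K n.+1 (true :: rcons w false) * triangle_sum K n w.
Proof.
move=> wf wrf fv fh.
pose mid := map (reflect_edge n.+1) (north_east 0 n).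
pose up := map (reflect_edge n.+1) (triangle_edges dg n).
pose low := triangle_edges dg n.+1.
have usq := uniq_square_edges dg n.
have : uniq (mid ++ low ++ up) by [].
rewrite cat_uniq => /and3P[umid dmid ulu].
move: (ulu); rewrite cat_uniq => /and3P[_ dlu uup].
rewrite /square_edges state_sum_cat //.
have <- : size mid = n.*2 by rewrite size_map size_north_east.
rewrite -(state_sum_map f _ umid); apply: eq_state_sum => g gf.
have insideml e : e \in mid ++ low -> inside n.+1 e.
  rewrite mem_cat mem_map_reflect =>
    /orP[/north_east_inside|/triangle_edges_inside] ie.
    by rewrite -(reflect_inside n.+1 e) ie.
  by rewrite ie.
transitivity (state_sum low g
    (fun h => triangle_sum K n (map g mid) * \prod_(v <- triangle n.+1) wt h v)).
  rewrite state_sum_cat //; apply: eq_state_sum => h hg.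
  under eq_state_sum do rewrite big_cat big_map.
  rewrite state_sum_mull; last first.
    move=> h' hh'; apply: eq_big_seq => -[x y]; rewrite mem_triangle /= => xy.
    apply: wt_local => /=; [lia..|] => e le; apply: hh'.
    rewrite mem_map_reflect; apply/negP => et.
    have be : bounded n.+1 e.
      apply: inside_bounded; rewrite -(reflect_inside n.+1 e).
      by apply: triangle_edges_inside et.
    have := level_reflect be; move: et; rewrite mem_triangle_edges => /and3P[_ _].
    by move: le xy; clear; lia.
  rewrite mulrC; congr (_ * _).
  transitivity (state_sum (triangle_edges dg n) (reflect_assignment n.+1 h)
      (fun k => \prod_(v <- triangle n) wt k v)).
    rewrite -[RHS](state_sum_reindex (E1 := up) (f1 := h) (t :=
      reflect_assignment n.+1)) //.
    - apply: eq_state_sum => k _; apply: eq_big_seq => -[x y];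
        rewrite mem_triangle /= => vt.
      by rewrite wt_reflect //=; lia.
    - by rewrite size_map.
    - exact: can_inj (@reflect_assignmentK n.+1).
    - move=> k kh e et; rewrite /reflect_assignment kh //.
      by rewrite mem_map_reflect reflect_edgeK.
  rewrite (state_sum_triangle wt_local lineK); last first.
    apply: wired_eq wrf => e npe; rewrite /reflect_assignment; congr (_ (+) _).
    have : reflect_edge n.+1 e \notin mid ++ low.
      apply: contra npe => /insideml; rewrite reflect_inside.
      by case/andP.
    by rewrite mem_cat negb_or => /andP[em el]; rewrite hg // gf.
  congr (triangle_sum K n _); rewrite -map_comp; apply/eq_in_map => e en.
  rewrite /reflect_assignment /= hg; last first.
    apply: contra dmid => el; apply/hasP; exists (reflect_edge n.+1 e).
      by rewrite mem_cat el.
    by rewrite mem_map_reflect reflect_edgeK.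
  (* Staircase edges are not negated by the reflection, so both triangles read the same word. *)
  suff -> : slanted e = false by [].
  move: en; rewrite mem_north_east /is_horiz /is_vert /slanted.
  by case/and4P => /orP[] /eqP -> _ _ _ /=; rewrite eqxx ?andbF.
rewrite state_sum_mull // (state_sum_triangle wt_local lineK); last first.
  apply: wired_eq wf => e npe; apply: gf; apply: contra npe => em.
  by have := insideml e; rewrite mem_cat em => /(_ isT)/andP[].
rewrite mulrC north_eastE map_cons map_rcons -/mid;
  congr (triangle_sum K _ (_ :: rcons _ _) * _).
- rewrite gf // mem_map_reflect mem_north_east0 reflect_edgeE /slanted /bounded
    /=; last by lia.
  by rewrite ?andbF /is_horiz /is_vert /positive /level /= ?xpair_eqE; lia.
- apply/negbTE;
    rewrite gf // mem_map_reflect mem_north_east0 reflect_edgeE /slanted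
      /bounded /=; last by lia.
  by rewrite ?andbF /is_horiz /is_vert /positive /level /= ?xpair_eqE; lia.
Qed.

End Square.

(** * The edge lists of the two models *)

Section WeightReflection.
Variables (n : nat) (g : dedge -> bool) (x y : nat).
Hypotheses (hx : (x < n)%N) (hy : (y < n)%N).
Let v : point := (x.+1, y.+1).

Lemma reflect_west :
  reflect_assignment n g (west v) = g (north (reflect_point n v)).
Proof.
rewrite /reflect_assignment reflect_edgeE /bounded /slanted /= ?eqxx ?andbF /=;
  last by lia.
by congr g; rewrite /north /vert /reflect_point /= !flipE; try lia;
  congr ((_, _), (_, _)); lia.
Qed.

Lemma reflect_south :
  reflect_assignment n g (south v) = g (east (reflect_point n v)).
Proof.
rewrite /reflect_assignment reflect_edgeE /bounded /slanted /= ?eqxx ?andbF /=;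
  last by lia.
by congr g; rewrite /east /horiz /reflect_point /= !flipE; try lia;
  congr ((_, _), (_, _)); lia.
Qed.

Lemma reflect_east :
  reflect_assignment n g (east v) = g (south (reflect_point n v)).
Proof.
rewrite /reflect_assignment reflect_edgeE /bounded /slanted /= ?eqxx ?andbF /=;
  last by lia.
by congr g; rewrite /south /vert /reflect_point /= !flipE; try lia;
  congr ((_, _), (_, _)); lia.
Qed.

Lemma reflect_north :
  reflect_assignment n g (north v) = g (west (reflect_point n v)).
Proof.
rewrite /reflect_assignment reflect_edgeE /bounded /slanted /= ?eqxx ?andbF /=;
  last by lia.
by congr g; rewrite /west /horiz /reflect_point /= !flipE; try lia;
  congr ((_, _), (_, _)); lia.
Qed.

Lemma reflect_northwest :
  reflect_assignment n g (northwest v) = ~~ g (northwest (reflect_point n v)).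
Proof.
rewrite /reflect_assignment reflect_edgeE; last by rewrite /bounded /=; lia.
have -> : slanted (northwest v) by rewrite /slanted /=; lia.
by congr (~~ g _); rewrite /northwest /diag /reflect_point /= !flipE; try lia;
  congr ((_, _), (_, _)); lia.
Qed.

Lemma reflect_southeast :
  reflect_assignment n g (southeast v) = ~~ g (southeast (reflect_point n v)).
Proof.
rewrite /reflect_assignment reflect_edgeE; last by rewrite /bounded /=; lia.
have -> : slanted (southeast v) by rewrite /slanted /=; lia.
by congr (~~ g _); rewrite /southeast /diag /reflect_point /= !flipE; try lia;
  congr ((_, _), (_, _)); lia.
Qed.

End WeightReflection.

Lemma wt6_reflect (R : comNzRingType) (s : R) n g v :
  (0 < v.1 <= n)%N -> (0 < v.2 <= n)%N ->
  wt6 s g (reflect_point n v) = wt6 s (reflect_assignment n g) v.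
Proof.
case: v => -[|x] [|y] // hx hy; rewrite /wt6.
rewrite reflect_west // reflect_south // reflect_east // reflect_north //.
by do 4![case: (g _)].
Qed.

(** The reflection exchanges west with north and south with east, hence the two sides of the
    balance. Each diagonal edge keeps its place, and negating both has the same effect as exchanging
    them. *)
Lemma wt20_reflect (R : comNzRingType) n g v :
  (0 < v.1 <= n)%N -> (0 < v.2 <= n)%N ->
  wt20 R g (reflect_point n v) = wt20 R (reflect_assignment n g) v.
Proof.
case: v => -[|x] [|y] // hx hy; rewrite /wt20.
rewrite reflect_west // reflect_south // reflect_east // reflect_north //.
rewrite reflect_northwest // reflect_southeast //.
by do 6![case: (g _)].
Qed.

Lemma mem_vertices n v :
  (v \in vertices n) = (0 < v.1 <= n)%N && (0 < v.2 <= n)%N.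
Proof.
case: v => x y; apply/allpairsP/idP => /= [[[a b] /= [ha hb [-> ->]]]|/andP[hx hy]].
  by move: ha hb; rewrite !mem_index_iota; lia.
by exists (x, y); rewrite !mem_index_iota !ltnS.
Qed.

Lemma uniq_vertices n : uniq (vertices n).
Proof. by apply: allpairs_uniq; rewrite ?iota_uniq // => -[a b] [c d]. Qed.

Lemma mem_horizontal n e :
  (e \in horizontal_edges n) = is_horiz e && inside n e.
Proof.
apply/allpairsP/andP => [[[a b] /= [ha hb ->]]|[/eqP he ie]].
  by move: ha hb;
    rewrite !mem_index_iota /is_horiz /inside /positive /= !xpair_eqE; lia.
exists e.1; rewrite {3}he !mem_index_iota; split => //;
  by move: ie; rewrite he /inside /positive /=; lia.
Qed.

Lemma mem_vertical n e :
  (e \in vertical_edges n) = is_vert e && inside n e.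
Proof.
apply/allpairsP/andP => [[[a b] /= [ha hb ->]]|[/eqP he ie]].
  by move: ha hb;
    rewrite !mem_index_iota /is_vert /inside /positive /= !xpair_eqE; lia.
exists e.1; rewrite {3}he !mem_index_iota; split => //;
  by move: ie; rewrite he /inside /positive /=; lia.
Qed.

Lemma mem_diagonal n e :
  (e \in diagonal_edges n) = is_diag e && inside n e.
Proof.
apply/allpairsP/andP => [[[a b] /= [ha hb ->]]|[/eqP he ie]].
  by move: ha hb;
    rewrite !mem_index_iota /is_diag /inside /positive /= !xpair_eqE; lia.
exists (e.1.1, e.2.2); rewrite {3}he !mem_index_iota; split => //;
  by move: ie; rewrite he /inside /positive /=; lia.
Qed.

Lemma uniq_horizontal n : uniq (horizontal_edges n).
Proof. by apply: allpairs_uniq;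
  rewrite ?iota_uniq // => -[a b] [c d] _ _ [-> ->]. Qed.

Lemma uniq_vertical n : uniq (vertical_edges n).
Proof. by apply: allpairs_uniq;
  rewrite ?iota_uniq // => -[a b] [c d] _ _ [-> ->]. Qed.

Lemma uniq_diagonal n : uniq (diagonal_edges n).
Proof. by apply: allpairs_uniq;
  rewrite ?iota_uniq // => -[a b] [c d] _ _ [-> ->]. Qed.

Lemma horiz_not_vert e : is_horiz e -> ~~ is_vert e.
Proof. by move/eqP->; rewrite /is_vert /= !xpair_eqE /=; lia. Qed.

Lemma diag_not_straight e : is_diag e -> ~~ (is_horiz e || is_vert e).
Proof. by move/eqP->; rewrite /is_vert /is_horiz /= !xpair_eqE /=; lia. Qed.

Lemma mem_inner6V n e :
  (e \in inner6V n) = (is_horiz e || is_vert e) && inside n e.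
Proof. by rewrite mem_cat mem_horizontal mem_vertical andb_orl. Qed.

Lemma mem_inner20V n e :
  (e \in inner20V n) = [|| is_horiz e, is_vert e | is_diag e] && inside n e.
Proof. by rewrite !mem_cat mem_horizontal mem_vertical mem_diagonal !andb_orl. Qed.

Lemma uniq_inner6V n : uniq (inner6V n).
Proof.
rewrite cat_uniq uniq_horizontal uniq_vertical andbT; apply/hasPn => e.
rewrite mem_vertical mem_horizontal;
  apply: contraL => /andP[/horiz_not_vert/negbTE->] //.
Qed.

Lemma uniq_inner20V n : uniq (inner20V n).
Proof.
rewrite /inner20V catA cat_uniq -/(inner6V n) uniq_inner6V uniq_diagonal andbT.
apply/hasPn => e;
  rewrite mem_diagonal mem_inner6V => /andP[/diag_not_straight/negbTE->] //.
Qed.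

(* On the boundary this is the DWBC1 orientation; its values on inner edges are
   irrelevant. *)
Definition boundary_state1 (n : nat) (e : dedge) : bool :=
  (e.1.1 == e.2.1) (+) (level e <= n.+1.*2)%N.

Definition boundary_state (c : dwbc) (n : nat) : dedge -> bool :=
  if c is DWBC1 then boundary_state1 n
  else reflect_assignment n (boundary_state1 n).

(** Among the boundary edges only the two corner diagonals have level [2n+2], so moving the
    threshold by one is exactly the difference between the two conditions. *)
Lemma boundary_stateE c n e :
  bounded n e -> [|| is_horiz e, is_vert e | is_diag e] ->
  boundary_state c n e
    = (e.1.1 == e.2.1) (+) (level e <= n.*2 + (if c is DWBC1 then 2 else 1))%N.
Proof.
case: c => be ke; first by rewrite /= /boundary_state1; congr (_ (+) _); lia.
have le := level_reflect be; rewrite /= /reflect_assignment /boundary_state1.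
have -> : (level (reflect_edge n e) <= n.+1.*2)%N = ~~ (level e <= n.*2 + 1)%N.
  by lia.
rewrite addbA -[RHS]negbK -[~~ (_ (+) _)]addbN -addNb; congr (_ (+) _).
rewrite reflect_edgeE //; move: ke be;
  rewrite /is_horiz /is_vert /is_diag /slanted /bounded.
by case: e {le} => [[a b] [c d]]; rewrite /= !xpair_eqE; case: ifP => /=; lia.
Qed.

(** Listed in the order of [boundary6V], so that the arcs there are obtained by orienting entry by
    entry. *)
Definition refs6 (n : nat) : seq dedge :=
     [seq horiz 0 y | y <- index_iota 1 n.+1]
  ++ [seq vert x 0 | x <- index_iota 1 n.+1]
  ++ [seq horiz n y | y <- index_iota 1 n.+1]
  ++ [seq vert x n | x <- index_iota 1 n.+1].

Definition refs_diag (n : nat) : seq dedge :=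
     [seq diag 0 y | y <- index_iota 1 n]
  ++ [seq diag x 0 | x <- index_iota 1 n]
  ++ [seq diag n y | y <- index_iota 1 n]
  ++ [seq diag x n | x <- index_iota 1 n].

Definition refs20 (n : nat) : seq dedge :=
  refs6 n ++ refs_diag n ++ [:: diag 0 n; diag n 0].

Lemma boundary6VE c n : boundary6V n = map (orient (boundary_state c n)) (refs6 n).
Proof.
rewrite /refs6 !map_cat -!map_comp.
congr (_ ++ (_ ++ (_ ++ _))); apply/eq_in_map => y; rewrite mem_index_iota => hy;
  rewrite /= /orient boundary_stateE /is_horiz /is_vert ?eqxx ?orbT // /bounded
    /=; try lia;
  case: ifP => //; rewrite /level /= => h; exfalso; move: h; case: c; lia.
Qed.

Lemma boundary_diagonalsE c n :
  boundary_diagonals n = map (orient (boundary_state c n)) (refs_diag n).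
Proof.
rewrite /refs_diag !map_cat -!map_comp.
congr (_ ++ (_ ++ (_ ++ _))); apply/eq_in_map => y; rewrite mem_index_iota => hy;
  rewrite /= /orient boundary_stateE /is_diag ?eqxx ?orbT // /bounded /=; try lia;
  case: ifP => //; rewrite /level /= => h; exfalso; move: h; case: c; lia.
Qed.

Lemma corner_diagonalsE c n : (0 < n)%N ->
  corner_diagonals c n = map (orient (boundary_state c n)) [:: diag 0 n; diag n 0].
Proof.
move=> n0; rewrite /= /orient !boundary_stateE /is_diag ?eqxx ?orbT // /bounded
  /=; try lia.
by case: c; congr [:: _; _]; case: ifP => //; rewrite /level /= => h;
  exfalso; move: h; lia.
Qed.

Lemma boundary20VE c n : (0 < n)%N ->
  boundary20V c n = map (orient (boundary_state c n)) (refs20 n).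
Proof.
move=> n0; rewrite /boundary20V (boundary6VE c) (boundary_diagonalsE c).
by rewrite corner_diagonalsE // -!map_cat.
Qed.

Section MemRefs.
Variables (a b c : nat) (e : dedge).

Lemma mem_map_horiz : (e \in [seq horiz c y | y <- index_iota a b])
  = [&& is_horiz e, e.1.1 == c & a <= e.1.2 < b]%N.
Proof.
apply/mapP/and3P => [[y hy ->]|[/eqP he /eqP hc hy]].
  by move: hy; rewrite mem_index_iota /is_horiz /= !eqxx.
by exists e.1.2; rewrite ?mem_index_iota // -hc.
Qed.

Lemma mem_map_vert : (e \in [seq vert x c | x <- index_iota a b])
  = [&& is_vert e, e.1.2 == c & a <= e.1.1 < b]%N.
Proof.
apply/mapP/and3P => [[y hy ->]|[/eqP he /eqP hc hy]].
  by move: hy; rewrite mem_index_iota /is_vert /= !eqxx.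
by exists e.1.1; rewrite ?mem_index_iota // -hc.
Qed.

Lemma mem_map_diagl : (e \in [seq diag c y | y <- index_iota a b])
  = [&& is_diag e, e.1.1 == c & a <= e.2.2 < b]%N.
Proof.
apply/mapP/and3P => [[y hy ->]|[/eqP he /eqP hc hy]].
  by move: hy; rewrite mem_index_iota /is_diag /= !eqxx.
by exists e.2.2; rewrite ?mem_index_iota // -hc.
Qed.

Lemma mem_map_diagr : (e \in [seq diag x c | x <- index_iota a b])
  = [&& is_diag e, e.2.2 == c & a <= e.1.1 < b]%N.
Proof.
apply/mapP/and3P => [[y hy ->]|[/eqP he /eqP hc hy]].
  by move: hy; rewrite mem_index_iota /is_diag /= !eqxx.
by exists e.1.1; rewrite ?mem_index_iota // -hc.
Qed.

End MemRefs.

Lemma mem_refs6 n e : (e \in refs6 n) =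
  [|| is_horiz e && [&& (e.1.1 == 0) || (e.1.1 == n) & 0 < e.1.2 <= n]
    | is_vert e && [&& (e.1.2 == 0) || (e.1.2 == n) & 0 < e.1.1 <= n]]%N.
Proof. by case: e => [[a b] [c d]];
  rewrite !mem_cat !mem_map_horiz !mem_map_vert /=; lia. Qed.

Lemma mem_refs_diag n e : (e \in refs_diag n) =
  is_diag e && ([&& (e.1.1 == 0) || (e.1.1 == n) & 0 < e.2.2 < n]
     || [&& (e.2.2 == 0) || (e.2.2 == n) & 0 < e.1.1 < n])%N.
Proof. by case: e => [[a b] [c d]];
  rewrite !mem_cat !mem_map_diagl !mem_map_diagr /=; lia. Qed.

Lemma mem_refs20 n e : (e \in refs20 n) =
  [|| e \in refs6 n, e \in refs_diag n | e \in [:: diag 0 n; diag n 0]].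
Proof. by rewrite mem_cat [X in _ || X]mem_cat. Qed.

Lemma uniq_map_iota (T : eqType) (F : nat -> T) a b :
  injective F -> uniq [seq F y | y <- index_iota a b].
Proof. by move=> Finj; rewrite map_inj_uniq // iota_uniq. Qed.

Lemma horiz_injr x : injective (horiz x). Proof. by move=> y y' []. Qed.
Lemma vert_injl y : injective (vert^~ y). Proof. by move=> x x' []. Qed.
Lemma diag_injr x : injective (diag x). Proof. by move=> y y' []. Qed.
Lemma diag_injl y : injective (diag^~ y). Proof. by move=> x x' []. Qed.

Lemma uniq_refs6 n : (0 < n)%N -> uniq (refs6 n).
Proof.
move=> n0; rewrite !cat_uniq !uniq_map_iota //=; try exact: horiz_injr;
  try exact: vert_injl.
rewrite !andbT; apply/and3P; split; apply/hasPn => -[[a b] [c d]];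
  rewrite ?mem_cat ?mem_map_horiz ?mem_map_vert /is_horiz /is_vert !xpair_eqE /=;
    lia.
Qed.

Lemma uniq_refs_diag n : (0 < n)%N -> uniq (refs_diag n).
Proof.
move=> n0; rewrite !cat_uniq !uniq_map_iota //=; try exact: diag_injr;
  try exact: diag_injl.
rewrite !andbT; apply/and3P; split; apply/hasPn => -[[a b] [c d]];
  rewrite ?mem_cat ?mem_map_diagl ?mem_map_diagr /is_diag !xpair_eqE /=; lia.
Qed.

Lemma uniq_full6 n : (0 < n)%N -> uniq (inner6V n ++ refs6 n).
Proof.
move=> n0; rewrite cat_uniq uniq_inner6V uniq_refs6 // andbT.
apply/hasPn => -[[a b] [c d]]; rewrite mem_refs6 mem_inner6V.
by rewrite /is_horiz /is_vert /inside /positive !xpair_eqE /=; lia.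
Qed.

Lemma uniq_full20 n : (0 < n)%N -> uniq (inner20V n ++ refs20 n).
Proof.
move=> n0; rewrite cat_uniq uniq_inner20V andTb; apply/andP; split.
  apply/hasPn => -[[a b] [c d]].
  rewrite mem_inner20V mem_refs20 mem_refs6 mem_refs_diag !inE.
  by rewrite /is_horiz /is_vert /is_diag /inside /positive !xpair_eqE /=; lia.
rewrite /refs20 cat_uniq uniq_refs6 // [uniq (refs_diag n ++ _)]cat_uniq.
rewrite uniq_refs_diag // !andTb; apply/and3P; split.
- apply/hasPn => -[[a b] [c d]].
  rewrite [_ \in refs_diag n ++ _]mem_cat mem_refs6 mem_refs_diag !inE.
  by rewrite /is_horiz /is_vert /is_diag !xpair_eqE /=; lia.
- by rewrite /= orbF !mem_refs_diag /=; lia.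
- by rewrite /= !inE andbT /diag !xpair_eqE; lia.
Qed.

(** * Local conditions and partition functions *)

Definition incident (v : point) (e : dedge) := (e.1 == v) || (e.2 == v).

Lemma count_incident (p : pred dedge) v (L S : seq dedge) :
  uniq L -> uniq S -> {subset S <= L} ->
  {in L, forall e, incident v e -> e \in S} ->
  (forall e, p e -> incident v e) ->
  count p L = count p S.
Proof.
move=> uL uS SL LS pv.
transitivity (count p (filter (mem S) L)).
  rewrite count_filter; apply: eq_in_count => e eL /=.
  by case: (boolP (p e)) => //= /pv /LS ->.
apply/permP; apply: uniq_perm; rewrite ?filter_uniq // => e.
by rewrite mem_filter /=; case: (boolP (e \in S)) => //= /SL.
Qed.

Section Degrees.
Variables (F : dedge -> bool) (v : point) (L S : seq dedge).
Hypotheses (uL : uniq L) (uS : uniq S) (SL : {subset S <= L}).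
Hypothesis LS : {in L, forall e, incident v e -> e \in S}.

Lemma indeg_star : indeg (map (orient F) L) v = indeg (map (orient F) S) v.
Proof.
rewrite /indeg !count_map; apply: count_incident uL uS SL LS _ => e /=.
by rewrite /orient /incident; case: ifP => _ /= ->; rewrite ?orbT.
Qed.

Lemma outdeg_star : outdeg (map (orient F) L) v = outdeg (map (orient F) S) v.
Proof.
rewrite /outdeg !count_map; apply: count_incident uL uS SL LS _ => e /=.
by rewrite /orient /incident; case: ifP => _ /= ->; rewrite ?orbT.
Qed.

End Degrees.

Lemma orient_to F e v : e.2 = v -> e.1 != v ->
  (((orient F e).2 == v) = F e) * (((orient F e).1 == v) = ~~ F e).
Proof.
by move=> <- /negbTE ne; rewrite /orient; case: (F e); rewrite /= eqxx ne.
Qed.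

Lemma orient_from F e v : e.1 = v -> e.2 != v ->
  (((orient F e).2 == v) = ~~ F e) * (((orient F e).1 == v) = F e).
Proof.
by move=> <- /negbTE ne; rewrite /orient; case: (F e); rewrite /= eqxx ne.
Qed.

Definition star6 (v : point) := [:: west v; south v; east v; north v].
Definition star20 (v : point) := star6 v ++ [:: northwest v; southeast v].

Lemma mem_full6 n e : (e \in inner6V n ++ refs6 n) =
  (is_horiz e || is_vert e) && inside n e
  || [|| is_horiz e && [&& (e.1.1 == 0) || (e.1.1 == n) & 0 < e.1.2 <= n]
    | is_vert e && [&& (e.1.2 == 0) || (e.1.2 == n) & 0 < e.1.1 <= n]]%N.
Proof. by rewrite mem_cat mem_inner6V mem_refs6. Qed.

Section Star.
Variables (F : dedge -> bool) (n x y : nat).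
Hypotheses (hx : (x < n)%N) (hy : (y < n)%N).
Let v : point := (x.+1, y.+1).

Lemma orient_star :
  ((((orient F (west v)).2 == v) = F (west v)) *
   (((orient F (west v)).1 == v) = ~~ F (west v))) *
  ((((orient F (south v)).2 == v) = F (south v)) *
   (((orient F (south v)).1 == v) = ~~ F (south v))) *
  ((((orient F (northwest v)).2 == v) = F (northwest v)) *
   (((orient F (northwest v)).1 == v) = ~~ F (northwest v))) *
  ((((orient F (east v)).2 == v) = ~~ F (east v)) *
   (((orient F (east v)).1 == v) = F (east v))) *
  ((((orient F (north v)).2 == v) = ~~ F (north v)) *
   (((orient F (north v)).1 == v) = F (north v))) *
  ((((orient F (southeast v)).2 == v) = ~~ F (southeast v)) *
   (((orient F (southeast v)).1 == v) = F (southeast v))).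
Proof.
split; [split; [split; [split; [split|]|]|]|];
  first [apply: orient_to | apply: orient_from] => //=;
  rewrite /v !xpair_eqE; lia.
Qed.

Lemma incident_straight e :
  is_horiz e || is_vert e -> incident v e -> e \in star6 v.
Proof.
case: e => [[a b] [c d]] /orP[] /eqP -> /orP[] /eqP [ha hb];
  by rewrite /= ha hb !inE eqxx ?orbT.
Qed.

Lemma incident_diag e :
  is_diag e -> incident v e -> (e == northwest v) || (e == southeast v).
Proof.
case: e => [[a b] [c d]] /eqP -> /orP[] /eqP [ha hb];
  by rewrite /= ha hb eqxx ?orbT.
Qed.

(** West and south edges point to [v] when [true], east and north edges when [false]. In-degree 2 is
    thus the conservation law, and the out-degree is the complement in 4. *)
Lemma balanced6_at :
  let A := map (orient F) (inner6V n ++ refs6 n) in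
  (indeg A v == 2) && (outdeg A v == 2)
    = (F (west v) + F (south v) == F (east v) + F (north v))%N.
Proof.
move=> A.
have uS : uniq (star6 v).
  by rewrite /= !inE /west /south /east /north /= !xpair_eqE; lia.
have SL : {subset star6 v <= inner6V n ++ refs6 n}.
  move=> e; rewrite /star6 !inE mem_full6.
  by case/or4P => /eqP ->;
    rewrite /west /south /east /north /is_horiz /is_vert /inside /positive
      /= !xpair_eqE; lia.
have LS : {in inner6V n ++ refs6 n, forall e, incident v e -> e \in star6 v}.
  move=> e; rewrite mem_full6 => ke.
  by apply: incident_straight; move: ke; lia.
have un : uniq (inner6V n ++ refs6 n) by apply: uniq_full6; lia.
rewrite /A (indeg_star F un uS SL LS) (outdeg_star F un uS SL LS).
rewrite /indeg /outdeg /=.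
rewrite !orient_star.
by case: (F _); case: (F _); case: (F _); case: (F _).
Qed.

Lemma balanced20_at :
  let A := map (orient F) (inner20V n ++ refs20 n) in
  (indeg A v == 3) && (outdeg A v == 3)
    = (F (west v) + F (south v) + F (northwest v)
        == F (east v) + F (north v) + F (southeast v))%N.
Proof.
move=> A.
have uS : uniq (star20 v).
  by rewrite /= !inE /west /south /east /north /northwest /southeast
    /= !xpair_eqE; lia.
have SL : {subset star20 v <= inner20V n ++ refs20 n}.
  move=> e; rewrite /star20 /star6 !inE.
  rewrite mem_cat mem_inner20V mem_refs20 mem_refs6 mem_refs_diag !inE.
  by case/or4P => [|||/or3P[]] /eqP ->;
    rewrite /west /south /east /north /northwest /southeast /is_horiz /is_vert
      /is_diag /inside /positive /= !xpair_eqE; lia.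
have LS : {in inner20V n ++ refs20 n, forall e, incident v e -> e \in star20 v}.
  move=> e eL ve; rewrite mem_cat.
  have : (is_horiz e || is_vert e) || is_diag e.
    move: eL; rewrite mem_cat mem_inner20V mem_refs20 mem_refs6 mem_refs_diag !inE.
    case/orP => [/andP[+ _]|/or3P[/orP[]|/andP[-> _]|/orP[]/eqP->]];
      rewrite ?orbT //.
    - by rewrite orbA.
    - by case/andP=> ->.
    - by case/andP=> ->; rewrite orbT.
    - by rewrite /is_diag eqxx !orbT.
    - by rewrite /is_diag eqxx !orbT.
  case/orP => [/incident_straight-> //|/incident_diag/(_ ve)].
  by rewrite !inE => ->; rewrite orbT.
have un : uniq (inner20V n ++ refs20 n) by apply: uniq_full20; lia.
rewrite /A (indeg_star F un uS SL LS) (outdeg_star F un uS SL LS).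
rewrite /indeg /outdeg /=.
rewrite !orient_star.
by case: (F _); case: (F _); case: (F _); case: (F _); case: (F _); case: (F _).
Qed.

Lemma orient_mem (L : seq dedge) e : uniq L ->
  e \in L -> rev_dedge e \notin L ->
  ((e \in map (orient F) L) = F e) * ((rev_dedge e \in map (orient F) L) = ~~ F e).
Proof.
move=> uL eL reL; have revK z : rev_dedge (rev_dedge z) = z by case: z.
split; apply/mapP/idP => [[z zL]|Fe].
- rewrite /orient; case: ifP => [Fz -> //|_ ez].
  by move: reL; rewrite ez revK zL.
- by exists e => //; rewrite /orient Fe.
- rewrite /orient; case: ifP => [_ ez|Fz /(congr1 rev_dedge)].
    by move: reL; rewrite ez zL.
  by rewrite !revK => ->; rewrite Fz.
- by exists e => //; rewrite /orient (negbTE Fe).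
Qed.

(** Occupied vertical edges run against their reference direction, so type b means four equal
    reference values. *)
Lemma type_b_at A :
  A =i map (orient F) (inner6V n ++ refs6 n) ->
  type_b A v = [&& F (west v) == F (south v), F (south v) == F (east v)
    & F (east v) == F (north v)]
    && (F (west v) + F (south v) == F (east v) + F (north v))%N.
Proof.
move=> eqA; rewrite /type_b /occupation /occupied_directions /v /= !eqA.
rewrite -[(x, y.+1, (x.+1, y.+1))]/(west v) -[(x.+1, y.+1, (x.+2, y.+1))]/(east v).
rewrite -[(x.+1, y.+2, (x.+1, y.+1))]/(rev_dedge (north v)).
rewrite -[(x.+1, y.+1, (x.+1, y))]/(rev_dedge (south v)).
have un : uniq (inner6V n ++ refs6 n) by apply: uniq_full6; lia.
have mem e : e \in star6 v ->
    (e \in inner6V n ++ refs6 n) /\ (rev_dedge e \notin inner6V n ++ refs6 n).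
  rewrite !inE !mem_full6.
  by case/or4P => /eqP ->; split;
    rewrite /west /south /east /north /is_horiz /is_vert /inside /positive
      /= !xpair_eqE; lia.
have memF e : e \in star6 v ->
    ((e \in map (orient F) (inner6V n ++ refs6 n)) = F e) *
    ((rev_dedge e \in map (orient F) (inner6V n ++ refs6 n)) = ~~ F e).
  by case/mem; apply: orient_mem.
rewrite (memF (west v)) ?(memF (east v)) ?(memF (north v)) ?(memF (south v));
  try by rewrite !inE eqxx ?orbT.
by case: (F _); case: (F _); case: (F _); case: (F _).
Qed.

End Star.

(** * Configuration counts as state sums *)

Section Sums.
Variables (R : comNzRingType) (s : R).

Lemma natr_all (T : Type) (p : pred T) (r : seq T) :
  (all p r)%:R = \prod_(i <- r) (p i)%:R :> R.
Proof.
by elim: r => [|i r IH]; rewrite ?big_nil // big_cons -IH /=; case: (p i);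
  rewrite ?mul1r ?mul0r.
Qed.

Lemma prod_all_count (T : Type) (p q : pred T) (r : seq T) :
  \prod_(i <- r) (if p i then if q i then s else 1 else 0)
    = if all p r then s ^+ count q r else 0.
Proof.
elim: r => [|i r IH]; rewrite ?big_nil // big_cons IH /=.
case: (p i); rewrite ?mul0r //=; case: (all p r); rewrite ?mulr0 //.
by case: (q i); rewrite ?mul1r // exprS.
Qed.

Lemma perm_indeg A B v : perm_eq A B -> indeg A v = indeg B v.
Proof. by move/permP; apply. Qed.

Lemma perm_outdeg A B v : perm_eq A B -> outdeg A v = outdeg B v.
Proof. by move/permP; apply. Qed.

Lemma perm_arcs (E B : seq dedge) f (o : orientation E) : uniq (E ++ B) ->
  perm_eq (arcs_of o ++ map (orient f) B)
    (map (orient (assignment f o)) (E ++ B)).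
Proof.
rewrite cat_uniq => /and3P[uE /hasPn EB _]; rewrite map_cat.
have -> : map (orient f) B = map (orient (assignment f o)) B.
  by apply/eq_in_map => e /EB eE; rewrite /orient assignment_notin.
by rewrite perm_cat2r; apply: perm_arcs_of.
Qed.

Lemma sum_config20V c n : (0 < n)%N ->
  #|config20V c n|%:R
    = state_sum (inner20V n) (boundary_state c n)
        (fun g => \prod_(v <- vertices n) wt20 R g v).
Proof.
move=> n0; rewrite -sum_orientations ?uniq_inner20V // -sum1_card natr_sum.
rewrite big_mkcond /=; apply: eq_bigr => o _; rewrite inE.
transitivity ((balanced n 3 (arcs_of o ++ boundary20V c n))%:R : R).
  by case: ifP.
rewrite /balanced natr_all; apply: eq_big_seq => -[x y].
rewrite mem_vertices /= => /andP[/andP[x0 hx] /andP[y0 hy]].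
case: x x0 hx => // x _ hx; case: y y0 hy => // y _ hy.
rewrite boundary20VE //.
have pA := perm_arcs (boundary_state c n) o (uniq_full20 n0).
by rewrite (perm_indeg _ pA) (perm_outdeg _ pA) balanced20_at.
Qed.

Lemma sum_config6V n : (0 < n)%N ->
  \sum_(C in config6V n) s ^+ count_b C
    = state_sum (inner6V n) (boundary_state1 n)
        (fun g => \prod_(v <- vertices n) wt6 s g v).
Proof.
move=> n0; rewrite -sum_orientations ?uniq_inner6V //.
rewrite big_mkcond /=; apply: eq_bigr => o _; rewrite inE.
rewrite /count_b /balanced -prod_all_count; apply: eq_big_seq => -[x y].
rewrite mem_vertices /= => /andP[/andP[x0 hx] /andP[y0 hy]].
case: x x0 hx => // x _ hx; case: y y0 hy => // y _ hy.
have := perm_arcs (boundary_state1 n) o (uniq_full6 n0).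
rewrite -(boundary6VE DWBC1) -/(arcs6V o) => pA.
rewrite (perm_indeg _ pA) (perm_outdeg _ pA) balanced6_at //.
rewrite (type_b_at hx hy (perm_mem pA)) /wt6 /w6.
by case: ifP => // ->; rewrite andbT.
Qed.

End Sums.

(** * State sums on the square and exchange of the boundary conditions *)

Section SquareSums.
Variables (R : comNzRingType).

Lemma perm_square n : perm_eq (square n) (vertices n.+1).
Proof.
apply: uniq_perm; rewrite ?uniq_square ?uniq_vertices // => v.
by rewrite mem_square mem_vertices.
Qed.

Lemma perm_square_edges6 n : perm_eq (square_edges false n) (inner6V n.+1).
Proof.
apply: uniq_perm; rewrite ?uniq_square_edges ?uniq_inner6V // => e.
by rewrite mem_square_edges mem_inner6V orbF.
Qed.

Lemma perm_square_edges20 n : perm_eq (square_edges true n) (inner20V n.+1).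
Proof.
apply: uniq_perm; rewrite ?uniq_square_edges ?uniq_inner20V // => e.
by rewrite mem_square_edges mem_inner20V.
Qed.

(** Under [DWBC2] the corner diagonals have the wrong value, so the range stops one row earlier. *)
Lemma boundary_state_wired c k n :
  (k + (if c is DWBC1 then 0 else 1) <= n)%N -> wired k (boundary_state c n).
Proof.
move=> kn m hm; have mn : (m <= n)%N by case: c kn; lia.
split; rewrite boundary_stateE /bounded /is_horiz /is_vert /is_diag ?eqxx ?orbT
  // /level /=;
  case: c kn => kn; lia.
Qed.

Lemma state_sum_square dg (wt : (dedge -> bool) -> point -> R) K E n :
  local_weight wt -> line_kernel dg wt K ->
  (forall m g v, (0 < v.1 <= m)%N -> (0 < v.2 <= m)%N ->
    wt g (reflect_point m v) = wt (reflect_assignment m g) v) ->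
  perm_eq (square_edges dg n) E ->
  state_sum E (boundary_state1 n.+1) (fun g => \prod_(v <- vertices n.+1) wt g v)
    = \sum_(w <- words n.*2)
        triangle_sum K n.+1 (true :: rcons w false) * triangle_sum K n w.
Proof.
move=> wtl lineK wtr pE; rewrite -(state_sum_perm _ _ (uniq_square_edges dg n) pE).
under eq_state_sum do rewrite -(perm_big _ (perm_square n)).
apply: state_sum_square_edges => //.
- by apply: (@boundary_state_wired DWBC1); rewrite addn0.
(* The reflected [DWBC1] state is by definition the [DWBC2] state, and the upper triangle does not
   reach its corners. *)
- by apply: (@boundary_state_wired DWBC2); rewrite addn1.
- by rewrite /boundary_state1 /level /=; lia.
- by rewrite /boundary_state1 /level /=; lia.
Qed.

Lemma inner20V_reflect n e :
  (reflect_edge n e \in inner20V n) = (e \in inner20V n).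
Proof.
rewrite !mem_inner20V reflect_inside; case ie: (inside n e);
  rewrite ?andbF // !andbT.
have be := inside_bounded ie.
by rewrite horiz_reflect // vert_reflect // diag_reflect // orbCA.
Qed.

Lemma state_sum_dwbc2 n :
  state_sum (inner20V n) (boundary_state DWBC2 n)
      (fun g => \prod_(v <- vertices n) wt20 R g v)
    = state_sum (inner20V n) (boundary_state DWBC1 n)
        (fun g => \prod_(v <- vertices n) wt20 R g v).
Proof.
rewrite -[LHS](state_sum_reindex (E1 := inner20V n) (f1 := boundary_state1 n)
  (t := reflect_assignment n)) ?uniq_inner20V //.
- apply: eq_state_sum => g _.
  rewrite (eq_big_seq (fun v => wt20 R g (reflect_point n v))); last first.
    by move=> v; rewrite mem_vertices => /andP[hx hy]; rewrite wt20_reflect.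
  rewrite -(big_map (reflect_point n) predT (wt20 R g)); apply: perm_big.
  have inj : injective (reflect_point n) := can_inj (@reflect_pointK n).
  apply: uniq_perm; rewrite ?(map_inj_uniq inj) ?uniq_vertices // => v.
  rewrite -{1}[v](reflect_pointK n) (mem_map inj) !mem_vertices.
  by case: v => x y; rewrite /reflect_point /flip /=; case: (leqP x n.+1);
    case: (leqP y n.+1); lia.
- exact: can_inj (@reflect_assignmentK n).
- move=> g gf e eE; rewrite /= /reflect_assignment gf //.
  by rewrite inner20V_reflect.
Qed.

End SquareSums.

Theorem theorem3p1 (R : rcfType) (n : nat) (hn : (1 <= n)%N) :
  #|config20V DWBC1 n|%:R
    = \sum_(C in config6V n) (Num.sqrt 2 : R) ^+ count_b C
  /\
  #|config20V DWBC2 n|%:R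
    = \sum_(C in config6V n) (Num.sqrt 2 : R) ^+ count_b C.
Proof.
have s2 : Num.sqrt 2 * Num.sqrt 2 = 2 :> R by rewrite -expr2 sqr_sqrtr ?ler0n.
rewrite !(sum_config20V R _ hn) state_sum_dwbc2.
suff -> : state_sum (inner20V n) (boundary_state DWBC1 n)
    (fun g => \prod_(v <- vertices n) wt20 R g v)
  = \sum_(C in config6V n) (Num.sqrt 2 : R) ^+ count_b C by [].
rewrite sum_config6V //; case: n hn => // n _.
rewrite (state_sum_square (@wt20_local R) (@line20_kernel R)
  (@wt20_reflect R) (perm_square_edges20 n)).
rewrite (state_sum_square (@wt6_local R _) (@line6_kernel R _)
  (@wt6_reflect R _) (perm_square_edges6 n)).
(* Both models are now sums over the same staircase words, compared triangle by triangle. *)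
apply: eq_sum_words => w sw.
by rewrite !(triangle_sum_line20 s2) //= size_rcons sw.
Qed.
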